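(* Let $m_n$ denote the length of the smallest interval after $n$ steps of Kakutani's interval-splitting process. There exists a constant $C\in[0,\infty)$ such that for every $n\in\mathbb N$, \[ \sup_{x\in[0,\infty)}\left|\Pr\left(\frac{n^2 m_n}{2}>x\right)-e^{-x}\right|\le \frac{C(1+\log n)}{\sqrt n}. \]
   Context: Kakutani's interval-splitting process: let $U_1,U_2,\dots$ be i.i.d. uniform random variables on $[0,1]$. At time $0$ the partition of $[0,1]$ consists of the single interval $[0,1]$. Given the partition at time $n\in\mathbb Z_+$ (which consists of $n+1$ intervals, whose lengths are a.s. distinct), let $[a,b]$ be the interval of maximal length; the partition at time $n+1$ is obtained by replacing $[a,b]$ by the two intervals $[a,a+U_{n+1}(b-a)]$ and $[a+U_{n+1}(b-a),b]$. Write $L_{n,1},\dots,L_{n,n+1}$ for the lengths of the $n+1$ intervals at time $n$ (in left-to-right order), $M_n:=\max_i L_{n,i}$ and $m_n:=\min_i L_{n,i}$. *)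

(* Defs.v *)
From HB Require Import structures.
From mathcomp Require Import all_boot all_order all_algebra.
From mathcomp Require Import all_classical all_reals all_analysis.
Set Implicit Arguments. Unset Strict Implicit. Unset Printing Implicit Defensive.
Import Order.TTheory GRing.Theory Num.Theory.
Local Open Scope classical_set_scope.
Local Open Scope ring_scope.

Section Kakutani.
Variable R : realType.

Definition seq_max (s : seq R) : R := foldr Num.max (head 0 s) s.
Definition seq_min (s : seq R) : R := foldr Num.min (head 0 s) s.

Definition kakutani_step (u : R) (s : seq R) : seq R :=
  let i := index (seq_max s) s in
  let L := nth 0 s i in
  take i s ++ [:: u * L; (1 - u) * L] ++ drop i.+1 s.

(* lengths L_{n,1},...,L_{n,n+1} at time n, driven by U_1, U_2, ... = u 1, u 2, ... *)
Fixpoint kakutani_lengths (u : nat -> R) (n : nat) : seq R :=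
  match n with
  | 0 => [:: 1]
  | k.+1 => kakutani_step (u k.+1) (kakutani_lengths u k)
  end.

Definition kakutani_min (u : nat -> R) (n : nat) : R :=
  seq_min (kakutani_lengths u n).
End Kakutani.

Definition mutually_independent {d} {T : measurableType d} {R : realType}
  (P : probability T R) (X : nat -> T -> R) : Prop :=
  forall (I : seq nat) (B : nat -> set R), uniq I ->
    (forall i, i \in I -> measurable (B i)) ->
    P (\bigcap_(i in [set j | j \in I]) (X i @^-1` B i)) =
    (\prod_(i <- I) P (X i @^-1` B i))%E.

Definition uniform01 {d} {T : measurableType d} {R : realType}
  (P : probability T R) (X : T -> R) : Prop :=
  measurable_fun setT X /\
  forall B : set R, measurable B ->
    P (X @^-1` B) = (@lebesgue_measure R) (B `&` `[0, 1]).

(* Main.v *)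
Require Import Defs.
From HB Require Import structures.
From mathcomp Require Import all_boot all_order all_algebra.
From mathcomp Require Import all_classical all_reals all_analysis.
From mathcomp Require Import measurable_realfun.
From mathcomp Require Import ring lra zify.
Import Order.TTheory GRing.Theory Num.Theory.
Import numFieldNormedType.Exports.
Local Open Scope classical_set_scope.
Local Open Scope ring_scope.
Set Implicit Arguments. Unset Strict Implicit. Unset Printing Implicit Defensive.

(** Write M_k for the longest interval at time k and y = 2x/n^2.  The minimum
    exceeds y at time n iff no cut produces a piece of length at most y, and, given
    the past, cut k+1 produces one with probability q_k = 2y/M_k (or 1).  Let
    r_k = (x - q_0 - ... - q_(k-1))^+.  The discounted survival indicator
    1[min > y] e^(-r_k) then has drift at most q_k^2 + (q_k - r_k)^+, so that
    |P(n^2 m_n / 2 > x) - e^(-x)| <= E(|q_0 + ... + q_(n-1) - x| + sum_k q_k^2).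

    Since M_k >= 1/(k+1), the squares are negligible, and it remains to compare
    S = 1/M_0 + ... + 1/M_(n-1) with n^2/4.  Up to rounding, S is the sum over
    i = 1..n of (n - N_i)^+, where N_i is the number of cuts needed to make all
    lengths at most 1/i.  The conditional expectation of N_i given the past is a
    martingale starting at 2i - 1 whose increments are bounded by 2 and vanish after
    time N_i, so Var N_i = O(i) and E|S - n^2/4| = O(n^(3/2)).

    All this gives a bound O(x / sqrt n) for x <= (ln n)/2; beyond that point both
    probabilities are small by monotonicity. *)

(** * Conditioning on the past *)

Section independence.
Context {d : measure_display} {T : measurableType d} {R : realType}.
Variables (P : probability T R) (U : nat -> T -> R).
Hypothesis mU : forall i, measurable_fun setT (U i).
Hypothesis iU : mutually_independent P U.

(** A pi-system generating the sigma-algebra of [U 1], ..., [U k]. The indices start at 1 because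
    cut [k.+1] is driven by [U k.+1]. *)
Definition cylinders (k : nat) : set (set T) :=
  [set A | exists2 B : nat -> set R, forall i, measurable (B i) &
    A = \bigcap_(i in [set j | j \in iota 1 k]) (U i @^-1` B i)].

Lemma cylinders_measurable k : cylinders k `<=` measurable.
Proof.
move=> _ [B mB ->]; apply: fin_bigcap_measurable => [|i _].
  by apply: (finite_seq (iota 1 k)).
by rewrite -[X in measurable X]setTI; exact: mU.
Qed.

Lemma cylinders_setI_closed k : setI_closed (cylinders k).
Proof.
move=> _ _ [B mB ->] [C mC ->]; exists (fun i => B i `&` C i) => [i|].
  exact: measurableI.
rewrite -bigcapI; apply: eq_bigcapr => i _.
by rewrite preimage_setI.
Qed.

Lemma sub_past_measurable k : <<s cylinders k >> `<=` measurable.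
Proof.
exact: smallest_sub (@sigma_algebra_measurable _ T) (@cylinders_measurable k).
Qed.

(** As functions of [A], both sides are finite measures. Mutual independence makes them agree on the
    pi-system [cylinders k], hence on the sigma-algebra it generates. *)
Lemma indep_past k (A : set T) (B : set R) :
  <<s cylinders k >> A -> measurable B ->
  (P (A `&` U k.+1 @^-1` B) = P A * P (U k.+1 @^-1` B))%E.
Proof.
move=> sA mB.
have mUB : measurable (U k.+1 @^-1` B).
  by rewrite -[X in measurable X]setTI; exact: mU.
have Pfin : (P (U k.+1 @^-1` B) \is a fin_num)%E by exact: fin_num_measure.
have c0 : 0 <= fine (P (U k.+1 @^-1` B)) by exact: fine_ge0.
pose m1 := mrestr P mUB; pose m2 := mscale (NngNum c0) P.
suff : m1 A = m2 A.
  by rewrite /m1 /m2 /mrestr /mscale/= fineK// muleC.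
apply: (@g_sigma_algebra_measure_unique _ _ _ (cylinders k) _ (fun=> setT)) => //.
- exact: cylinders_measurable.
- by move=> i; exists (fun=> setT) => //; rewrite bigcapT.
- by rewrite bigcup_const//; exists 0%N.
- exact: cylinders_setI_closed.
- move=> _ [C mC ->].
  change (m1 (\bigcap_(i in [set j | j \in iota 1 k]) (U i @^-1` C i)) =
          m2 (\bigcap_(i in [set j | j \in iota 1 k]) (U i @^-1` C i))).
  rewrite /m1 /m2 /mrestr /mscale/= fineK// muleC.
  have kI : k.+1 \notin iota 1 k by rewrite mem_iota add1n ltnn andbF.
  (* [D] puts [B] at index [k.+1] and [C] elsewhere, so that a single use of independence covers the
     index list [k.+1 :: iota 1 k]. *)
  pose D i := if i == k.+1 then B else C i.
  have DC i : i \in iota 1 k -> D i = C i.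
    by rewrite /D; case: eqP => // ->; rewrite (negbTE kI).
  have mD i : measurable (D i) by rewrite /D; case: ifP.
  have := @iU (k.+1 :: iota 1 k) D; rewrite [uniq _]/= kI iota_uniq.
  move=> /(_ isT (fun i _ => mD i)).
  rewrite big_cons {2}/D eqxx.
  have -> : (\prod_(i <- iota 1 k) P (U i @^-1` D i) =
             \prod_(i <- iota 1 k) P (U i @^-1` C i))%E.
    by apply: eq_big_seq => i iI; rewrite DC.
  rewrite -(@iU (iota 1 k) C (iota_uniq _ _) (fun i _ => mC i)) muleC => <-.
  congr (P _); apply/seteqP; split => [w [wC wB] i|w wD].
    rewrite /= in_cons => /orP[/eqP->|iI]; first by rewrite /D eqxx.
    by rewrite DC//; exact: wC.
  split=> [i iI|]; last by have := wD k.+1; rewrite /= /D eqxx; apply; exact: mem_head.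
  by have := wD i; rewrite /= DC//; apply; rewrite in_cons iI orbT.
- move=> _; rewrite /m1 /mrestr/=.
  by apply: (le_lt_trans (probability_le1 P _)); rewrite ?ltry//; apply: measurableI.
Qed.
End independence.

Section past_integral.
Context {d : measure_display} {T : measurableType d} {R : realType}.
Variables (P : probability T R) (U : nat -> T -> R).
Hypothesis mU : forall i, measurable_fun setT (U i).
Hypothesis iU : mutually_independent P U.

Local Notation rT := (measurableTypeR R).
Local Notation past k := (g_sigma_algebraType (cylinders U k)).

Lemma measurable_past k i : (0 < i <= k)%N ->
  measurable_fun setT (U i : past k -> R).
Proof.
move=> ik _ B mB; rewrite setTI; apply: sub_sigma_algebra.
exists (fun j => if j == i then B else setT) => [j|]; first by case: ifP.
apply/seteqP; split=> [w wB j _|w /(_ i)] /=.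
  by case: eqP => // ->.
by rewrite eqxx; apply; rewrite /= mem_iota add1n ltnS.
Qed.

Lemma measurable_to_past k : measurable_fun setT (id : T -> past k).
Proof.
by move=> _ A sA; rewrite setTI; exact: (sub_past_measurable mU sA).
Qed.


(** By [indep_past], the joint law of the past (the identity map into the coarser sigma-algebra) and
    of [U k.+1] is the product of their laws. Tonelli then integrates out the new coordinate
    first. *)
Lemma integral_past k (f : past k * rT -> \bar R) :
  measurable_fun setT f -> (forall z, 0 <= f z)%E ->
  (\int[P]_w f (w, U k.+1 w) =
   \int[P]_w \int[pushforward P (U k.+1 : T -> rT)]_v f (w, v))%E.
Proof.
move=> mf f0.
pose X : {mfun T >-> rT} :=
  HB.pack (U k.+1 : T -> rT) (isMeasurableFun.Build _ _ T rT _ (mU k.+1)).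
pose I : {mfun T >-> past k} :=
  HB.pack (id : T -> past k) (isMeasurableFun.Build _ _ _ _ _ (@measurable_to_past k)).
pose Z w : past k * rT := (w, U k.+1 w).
have mZ : measurable_fun setT Z.
  by apply/measurable_fun_pairP; split; [exact: measurable_to_past|exact: mU].
rewrite -[LHS]/(\int[P]_(w in Z @^-1` setT) (f \o Z) w)%E.
rewrite -ge0_integral_pushforward//.
rewrite -(@eq_measure_integral _ _ _ _ _
  (distribution P I \x distribution P X)%E); last first.
  move=> A mA _; apply: product_measure_unique => // B C mB mC.
  exact: (indep_past mU iU).
rewrite fubini_tonelli1// ge0_integral_pushforward//.
exact: measurable_fun_fubini_tonelli_F.
by move=> x _; apply: integral_ge0.
Qed.
End past_integral.

(** * Bounded functionals of the first cuts *)

Section functionals.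
Context {R : realType}.
Implicit Types (u : nat -> R) (H : (nat -> R) -> R).

Definition unit_seq u := forall i, 0 <= u i <= 1.

Definition upd u k v : nat -> R := fun i => if i == k then v else u i.

Lemma upd_same u k v : upd u k v k = v.
Proof. by rewrite /upd eqxx. Qed.

Lemma unit_seq_upd u k v : unit_seq u -> 0 <= v <= 1 -> unit_seq (upd u k v).
Proof. by move=> u01 v01 i; rewrite /upd; case: eqP. Qed.

(* The quantification over all measurable spaces allows H to be evaluated along the
   sequence U and along U with its last coordinate replaced by a free variable. *)
Definition adapted k H :=
  forall (d : measure_display) (S : measurableType d) (V : nat -> S -> R),
    (forall i, (0 < i <= k)%N -> measurable_fun setT (V i)) ->
    measurable_fun setT (fun s => H (fun i => V i s)).

(** The bound is asked on [0, 1]-valued sequences, where all the lengths lie in [0, 1]. *)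
Definition bounded_adapted k H :=
  adapted k H /\ exists K, forall u, unit_seq u -> `|H u| <= K.

Lemma adaptedW k l H : (k <= l)%N -> adapted k H -> adapted l H.
Proof.
move=> kl aH d S V mV; apply: aH => i /andP[i0 ik].
by apply: mV; rewrite i0 (leq_trans ik).
Qed.

Lemma bounded_adaptedW k l H : (k <= l)%N ->
  bounded_adapted k H -> bounded_adapted l H.
Proof. by move=> kl [aH bH]; split=> //; exact: adaptedW aH. Qed.

Lemma bounded_adapted_cst k c : bounded_adapted k (fun=> c).
Proof.
split; first by move=> d S V _; exact: measurable_cst.
by exists `|c|.
Qed.

Lemma bounded_adaptedD k H1 H2 : bounded_adapted k H1 -> bounded_adapted k H2 ->
  bounded_adapted k (fun u => H1 u + H2 u).
Proof.
move=> [a1 [K1 b1]] [a2 [K2 b2]]; split.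
  by move=> d S V mV; apply: measurable_funD; [exact: a1|exact: a2].
exists (K1 + K2) => u u01; apply: (le_trans (ler_normD _ _)).
by apply: lerD; [exact: b1|exact: b2].
Qed.

Lemma bounded_adaptedM k H1 H2 : bounded_adapted k H1 -> bounded_adapted k H2 ->
  bounded_adapted k (fun u => H1 u * H2 u).
Proof.
move=> [a1 [K1 b1]] [a2 [K2 b2]]; split.
  by move=> d S V mV; apply: measurable_funM; [exact: a1|exact: a2].
exists (K1 * K2) => u u01; rewrite normrM.
by apply: ler_pM => //; [exact: b1|exact: b2].
Qed.

Lemma bounded_adaptedN k H : bounded_adapted k H ->
  bounded_adapted k (fun u => - H u).
Proof.
move=> bH; rewrite (_ : (fun _ => _) = fun u => -1 * H u); last first.
  by apply/funext => u; rewrite mulN1r.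
by apply: bounded_adaptedM => //; exact: bounded_adapted_cst.
Qed.

Lemma bounded_adaptedB k H1 H2 : bounded_adapted k H1 -> bounded_adapted k H2 ->
  bounded_adapted k (fun u => H1 u - H2 u).
Proof.
by move=> b1 b2; apply: bounded_adaptedD => //; exact: bounded_adaptedN.
Qed.

Lemma bounded_adapted_sqr k H :
  bounded_adapted k H -> bounded_adapted k (fun u => H u ^+ 2).
Proof.
move=> bH; rewrite (_ : (fun _ => _) = fun u => H u * H u).
  exact: bounded_adaptedM.
by apply/funext => u; rewrite expr2.
Qed.

Lemma bounded_adapted_sum k I (s : seq I) (H : I -> (nat -> R) -> R) :
  (forall i, bounded_adapted k (H i)) ->
  bounded_adapted k (fun u => \sum_(i <- s) H i u).
Proof.
move=> bH; elim: s => [|i s IHs].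
  rewrite (_ : (fun _ => _) = fun=> 0); first exact: bounded_adapted_cst.
  by apply/funext => u; rewrite big_nil.
rewrite (_ : (fun _ => _) = fun u => H i u + \sum_(j <- s) H j u).
  exact: bounded_adaptedD.
by apply/funext => u; rewrite big_cons.
Qed.

Lemma bounded_adapted_max k H1 H2 :
  bounded_adapted k H1 -> bounded_adapted k H2 ->
  bounded_adapted k (fun u => Num.max (H1 u) (H2 u)).
Proof.
move=> [a1 [K1 b1]] [a2 [K2 b2]]; split.
  by move=> d S V mV; apply: measurable_maxr; [exact: a1|exact: a2].
exists (Num.max K1 K2) => u u01; rewrite le_max.
by have [_|_] := leP (H1 u) (H2 u); rewrite ?b1 ?b2 ?orbT.
Qed.

Lemma bounded_adapted_norm k H : bounded_adapted k H ->
  bounded_adapted k (fun u => `|H u|).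
Proof.
move=> [aH [K bH]]; split; last by exists K => u u01; rewrite normr_id bH.
by move=> d S V mV; apply: measurableT_comp; [exact: normr_measurable|exact: aH].
Qed.

Lemma measurable_coord k H u : adapted k H ->
  measurable_fun setT (fun v : R => H (upd u k v)).
Proof.
move=> aH; apply: (aH _ _ (fun i v => upd u k v i)) => i _; rewrite /upd.
case: eqP => // _; exact: measurable_cst.
Qed.

Lemma integrable_coord k H u : unit_seq u -> bounded_adapted k H ->
  (@lebesgue_measure R).-integrable `[0, 1] (EFin \o (fun v => H (upd u k v))).
Proof.
move=> u01 [aH [K bH]]; apply: measurable_bounded_integrable => //.
- by rewrite /= lebesgue_measure_itv/= lte_fin ltr01 oppr0 adde0 ltry.
- by apply: measurable_funTS; exact: measurable_coord.
- exists K; split; first exact: num_real.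
  move=> x Kx v /=; rewrite in_itv/= => v01.
  by apply: (le_trans (bH _ _) (ltW Kx)); exact: unit_seq_upd.
Qed.

End functionals.

(** * Expectations along the driving sequence *)

Section expectation.
Context {d : measure_display} {T : measurableType d} {R : realType}.
Variables (P : probability T R) (U : nat -> T -> R).
Hypothesis uU : forall i, uniform01 P (U i).
Hypothesis iU : mutually_independent P U.

Local Notation rT := (measurableTypeR R).
Let mU i : measurable_fun setT (U i) := (uU i).1.

Definition clamp (x : R) := Num.max 0 (Num.min 1 x).

Lemma clamp01 x : 0 <= clamp x <= 1.
Proof. by rewrite /clamp le_max lexx ge_max ler01 ge_min lexx. Qed.

Lemma clamp_id x : 0 <= x <= 1 -> clamp x = x.
Proof. by move=> /andP[x0 x1]; rewrite /clamp min_r// max_r. Qed.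

Lemma measurable_clamp : measurable_fun setT clamp.
Proof. by apply: measurable_maxr => //; exact: measurable_minr. Qed.

(* The U i lie in [0, 1] only almost surely. *)
Definition drive (w : T) : nat -> R := fun i => clamp (U i w).

Lemma unit_seq_drive w : unit_seq (drive w).
Proof. by move=> i; exact: clamp01. Qed.

Definition expect (H : (nat -> R) -> R) : R := \int[P]_w H (drive w).

Lemma measurable_drive k H : adapted k H ->
  measurable_fun setT (fun w => H (drive w)).
Proof.
move=> aH; apply: (aH _ _ (fun i w => clamp (U i w))) => i _.
exact: measurableT_comp measurable_clamp (mU i).
Qed.

Lemma integrable_drive k H : bounded_adapted k H ->
  P.-integrable setT (EFin \o (fun w => H (drive w))).
Proof.
move=> [aH [K bH]]; apply: measurable_bounded_integrable => //.
- by rewrite /= probability_setT ltry.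
- exact: measurable_drive aH.
- exists K; split; first exact: num_real.
  move=> x Kx w /= _; apply: (le_trans (bH _ _) (ltW Kx)).
  exact: unit_seq_drive.
Qed.

Lemma integral_uniform01 i (f : rT -> \bar R) :
  measurable_fun setT f -> (forall v, 0 <= f v)%E ->
  (\int[pushforward P (U i : T -> rT)]_v f v =
   \int[lebesgue_measure]_(v in `[0%R, 1%R]) f v)%E.
Proof.
move=> mf f0.
pose X : {mfun T >-> rT} :=
  HB.pack (U i : T -> rT) (isMeasurableFun.Build _ _ T rT _ (mU i)).
rewrite -[pushforward P _]/(distribution P X).
have X0 : distribution P X (~` (`[0, 1]%classic : set rT)) = 0%E.
  have := (uU i).2 _ (measurableC (measurable_itv `[0, 1]%R)).
  by rewrite setICl measure0.
rewrite (ge0_negligible_integral _ _ _ _ X0)//; last exact: measurableC.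
rewrite setTD setCK; apply: eq_measure_integral => A mA A01.
by rewrite -[in RHS](setIidl A01); exact: (uU i).2.
Qed.

(** A one-step drift bound without conditional expectations: averaging over coordinate [k.+1] with
    the earlier ones frozen plays the role of conditioning on the past. All martingale arguments
    below go through this lemma. *)
Lemma expect_le_step k H G :
  bounded_adapted k.+1 H -> bounded_adapted k G ->
  (forall u, unit_seq u ->
    \int[lebesgue_measure]_(v in `[0, 1]) H (upd u k.+1 v) <= G u) ->
  expect H <= expect G.
Proof.
move=> bH bG HG; have [aH [K KH]] := bH.
(* Adding the bound [K] makes the integrand nonnegative, as Tonelli requires; [K] is added to both
   sides and cancels. *)
pose F (z : g_sigma_algebraType (cylinders U k) * rT) :=
  H (upd (fun i => clamp (U i z.1)) k.+1 (clamp z.2)) + K.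
have F0 z : 0 <= F z.
  rewrite -lerBlDr sub0r; have := KH (upd (fun i => clamp (U i z.1)) k.+1 (clamp z.2)).
  rewrite ler_norml => /(_ _)/andP[]//; apply: unit_seq_upd; last exact: clamp01.
  by move=> i; exact: clamp01.
have mF : measurable_fun setT F.
  apply: measurable_funD => //.
  apply: (aH _ _ (fun i (z : g_sigma_algebraType (cylinders U k) * rT) =>
    upd (fun j => clamp (U j z.1)) k.+1 (clamp z.2) i)).
  rewrite /upd => i /andP[i0]; rewrite leq_eqVlt => /orP[/eqP ->|ik].
    rewrite eqxx; apply: (measurableT_comp measurable_clamp).
    exact: measurable_snd.
  rewrite ltn_eqF//; apply: (measurableT_comp measurable_clamp).
  apply: (measurableT_comp _ measurable_fst).
  by apply: measurable_past; rewrite i0.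
have [iH iG] := (integrable_drive bH, integrable_drive bG).
have iK : P.-integrable setT (EFin \o (fun=> K)).
  exact: integrable_drive (bounded_adapted_cst 0 K).
have P1 : fine (P setT) = 1 by rewrite /= probability_setT.
have expectDK H' : P.-integrable setT (EFin \o (fun w => H' (drive w))) ->
    expect H' + K = \int[P]_w (H' (drive w) + K).
  by move=> iH'; rewrite RintegralD// Rintegral_cst// P1 mulr1.
rewrite -(lerD2r K) !expectDK//.
have iHK : P.-integrable setT (EFin \o (fun w => H (drive w) + K)).
  have := integrableD measurableT iH iK; apply: eq_integrable => //.
have iGK : P.-integrable setT (EFin \o (fun w => G (drive w) + K)).
  have := integrableD measurableT iG iK; apply: eq_integrable => //.
rewrite -lee_fin /Rintegral !fineK; last 2 first.
- exact: integrable_fin_num iGK.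
- exact: integrable_fin_num iHK.
have -> : (\int[P]_w (H (drive w) + K)%:E = \int[P]_w (F (w, U k.+1 w))%:E)%E.
  apply: eq_integral => w _; congr ((H _ + K)%:E).
  by apply/funext => i; rewrite /upd/=; case: eqP => [->|].
rewrite (integral_past mU iU (f := fun z => (F z)%:E)); last 2 first.
- exact/measurable_EFinP.
- by move=> z; rewrite lee_fin.
pose X : {mfun T >-> rT} :=
  HB.pack (U k.+1 : T -> rT) (isMeasurableFun.Build _ _ T rT _ (mU k.+1)).
have F0E z : (0 <= (F z)%:E)%E by rewrite lee_fin.
apply: ge0_le_integral => //.
- by move=> w _; apply: (integral_ge0 (distribution P X)).
- have mFF := @measurable_fun_fubini_tonelli_F _ _ _ _ R (distribution P X)
    (fun z => (F z)%:E)
    (iffRL (measurable_EFinP _ _) mF) F0E.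
  exact: (measurableT_comp mFF (measurable_to_past mU (k := k))).
- by case/integrableP: iGK.
move=> w _; rewrite (integral_uniform01 k.+1 (f := fun v => (F (w, v))%:E)); last 2 first.
- exact/measurable_EFinP/(measurableT_comp mF)/pair1_measurable.
- by move=> v; rewrite lee_fin.
have uw := unit_seq_drive w.
have iw := integrable_coord uw bH.
have iKw : (@lebesgue_measure R).-integrable `[0, 1] (EFin \o (fun=> K)).
  exact: integrable_coord uw (bounded_adapted_cst 0 K).
have -> : (\int[lebesgue_measure]_(v in `[0%R, 1%R]) (F (w, v))%:E =
  \int[lebesgue_measure]_(v in `[0%R, 1%R]) (H (upd (drive w) k.+1 v) + K)%:E)%E.
  apply: eq_integral => v; rewrite inE/= in_itv/= => v01.
  by rewrite /F /= clamp_id.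
have iHKw : (@lebesgue_measure R).-integrable `[0, 1]
    (EFin \o (fun v => H (upd (drive w) k.+1 v) + K)).
  have mI : measurable (`[0, 1]%classic : set rT) by exact: measurable_itv.
  have := integrableD mI iw iKw; apply: eq_integrable => //.
rewrite -(fineK (integrable_fin_num _ iHKw))// lee_fin.
rewrite -/(Rintegral _ _ _) RintegralD// lerD ?HG//.
by rewrite Rintegral_cst//= lebesgue_measure_itv/= lte_fin ltr01 oppr0 adde0 mulr1.
Qed.
End expectation.

(** * Lengths and the longest interval *)

Section splitting.
Context {R : realType}.
Implicit Types (u : nat -> R) (s : seq R) (x y v : R).

Lemma seq_max_ge s x : x \in s -> x <= seq_max s.
Proof.
rewrite /seq_max; move: (head 0 s) => h.
elim: s => //= a s IHs; rewrite in_cons le_max => /predU1P[->|/IHs ->].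
  by rewrite lexx.
by rewrite orbT.
Qed.

Lemma seq_max_mem s : s != [::] -> seq_max s \in s.
Proof.
case: s => // a s _; rewrite /seq_max/=.
have : foldr Num.max a s \in a :: s.
  elim: s => /= [|b s IHs]; first by rewrite mem_head.
  rewrite !in_cons; case: leP => _; last by rewrite eqxx orbT.
  by move: IHs; rewrite in_cons => /orP[->//|->]; rewrite !orbT.
by case: leP => // _ _; rewrite mem_head.
Qed.

Lemma lt_seq_min y s : s != [::] -> (y < seq_min s) = all (fun x => y < x) s.
Proof.
case: s => // a s _; rewrite /seq_min/= lt_min; case: (ltP y a) => //= ya.
by elim: s => //= b s <-; rewrite lt_min.
Qed.

(** The old maximum is put back on the left, so that no removal from a list appears. Positions are
    forgotten: only symmetric functions of the lengths are used later. *)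
Lemma perm_kakutani_step v s : s != [::] ->
  perm_eq (seq_max s :: kakutani_step v s)
    [:: v * seq_max s, (1 - v) * seq_max s & s].
Proof.
move=> s0; have Ms := seq_max_mem s0; rewrite /kakutani_step.
set i := index _ _; have Mi : nth 0 s i = seq_max s by exact: nth_index.
have is_ : (i < size s)%N by rewrite index_mem.
rewrite Mi; move: (seq_max s) Mi => M Mi.
rewrite -[in X in perm_eq _ X](cat_take_drop i s) (drop_nth 0 is_) Mi.
by apply/permP => a; rewrite /= !count_cat /=; lia.
Qed.

Lemma kakutani_step_neq0 v s : kakutani_step v s != [::].
Proof. by rewrite -size_eq0 /kakutani_step !size_cat/= addnCA. Qed.

Lemma kakutani_lengths_neq0 u k : kakutani_lengths u k != [::].
Proof. by case: k => //= k; exact: kakutani_step_neq0. Qed.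

Definition kmax u k := seq_max (kakutani_lengths u k).

Lemma kmax_mem u k : kmax u k \in kakutani_lengths u k.
Proof. exact/seq_max_mem/kakutani_lengths_neq0. Qed.

Lemma perm_kakutani u k :
  perm_eq (kmax u k :: kakutani_lengths u k.+1)
    [:: u k.+1 * kmax u k, (1 - u k.+1) * kmax u k & kakutani_lengths u k].
Proof. exact/perm_kakutani_step/kakutani_lengths_neq0. Qed.

Lemma size_kakutani_lengths u k : size (kakutani_lengths u k) = k.+1.
Proof.
elim: k => // k IHk; have /perm_size := perm_kakutani u k.
by move=> /= []; rewrite IHk.
Qed.

Lemma sum_kakutani (phi : R -> R) u k :
  \sum_(L <- kakutani_lengths u k.+1) phi L =
  \sum_(L <- kakutani_lengths u k) phi L - phi (kmax u k) +
  (phi (u k.+1 * kmax u k) + phi ((1 - u k.+1) * kmax u k)).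
Proof.
have : \sum_(L <- kmax u k :: kakutani_lengths u k.+1) phi L =
  \sum_(L <- [:: u k.+1 * kmax u k, (1 - u k.+1) * kmax u k
              & kakutani_lengths u k]) phi L.
  exact/perm_big/perm_kakutani.
by rewrite !big_cons => h; lra.
Qed.

Lemma eq_kakutani_lengths u1 u2 k :
  (forall i, (0 < i <= k)%N -> u1 i = u2 i) ->
  kakutani_lengths u1 k = kakutani_lengths u2 k.
Proof.
elim: k => //= k IHk eq_u; rewrite eq_u ?leqnn// IHk// => i /andP[i0 ik].
by rewrite eq_u// i0 leqW.
Qed.

Lemma kakutani_lengths_upd u k l v : (l <= k)%N ->
  kakutani_lengths (upd u k.+1 v) l = kakutani_lengths u l.
Proof.
move=> lk; apply: eq_kakutani_lengths => i /andP[_ il]; rewrite /upd ltn_eqF//.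
by rewrite ltnS (leq_trans il).
Qed.

Lemma kmax_upd u k l v : (l <= k)%N -> kmax (upd u k.+1 v) l = kmax u l.
Proof. by move=> lk; rewrite /kmax kakutani_lengths_upd. Qed.

Lemma kakutani_length_ge0 u k L : unit_seq u ->
  L \in kakutani_lengths u k -> 0 <= L.
Proof.
move=> u01; suff /allP : all (fun x => 0 <= x) (kakutani_lengths u k) by exact.
elim: k => [|k IHk]; first by rewrite /= ler01.
have /perm_all := perm_kakutani u k.
move=> /(_ (fun x => 0 <= x)) /= h.
have M0 : 0 <= kmax u k by move/allP: IHk; apply; exact: kmax_mem.
have /andP[u0 u1] := u01 k.+1.
by move: h; rewrite M0 IHk !mulr_ge0// subr_ge0.
Qed.

Lemma sum_kakutani_lengths u k : \sum_(L <- kakutani_lengths u k) L = 1.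
Proof.
elim: k => [|k IHk]; first by rewrite big_seq1.
rewrite (sum_kakutani id) IHk; lra.
Qed.

Lemma sum_le_size s M : {in s, forall x, x <= M} ->
  \sum_(x <- s) x <= (size s)%:R * M.
Proof.
rewrite mulr_natl; elim: s => [|L s IHs] LM; first by rewrite big_nil.
rewrite big_cons /= mulrS lerD ?LM ?mem_head// IHs// => x xs.
by rewrite LM// in_cons xs orbT.
Qed.

(** The maximum of [k.+1] numbers with sum 1 is at least their mean. *)
Lemma kmax_ge u k : 1 <= k.+1%:R * kmax u k.
Proof.
have := sum_le_size (@seq_max_ge (kakutani_lengths u k)).
by rewrite sum_kakutani_lengths size_kakutani_lengths.
Qed.

Lemma kmax_gt0 u k : 0 < kmax u k.
Proof.
rewrite -(pmulr_rgt0 _ (ltr0Sn R k)).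
exact: lt_le_trans (kmax_ge u k).
Qed.

Lemma kmax_le u k : unit_seq u -> kmax u k.+1 <= kmax u k.
Proof.
move=> u01; have := kmax_mem u k.+1.
suff /allP : all (fun x => x <= kmax u k) (kakutani_lengths u k.+1) by exact.
have /perm_all := perm_kakutani u k.
move=> /(_ (fun x => x <= kmax u k)) /=; rewrite lexx /= => ->.
have M0 := ltW (kmax_gt0 u k).
have /andP[u0 u1] := u01 k.+1.
rewrite !ler_piMl ?gerBl//=; apply/allP => L; exact: seq_max_ge.
Qed.

Lemma kmax_nonincreasing u k l : unit_seq u -> (k <= l)%N ->
  kmax u l <= kmax u k.
Proof.
move=> u01 /subnK <-; elim: (l - k)%N => // m IHm.
by rewrite addSn (le_trans (kmax_le _ _)).
Qed.

Lemma inv_kmax_le u k : (kmax u k)^-1 <= k.+1%:R.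
Proof. by rewrite -[leLHS]mul1r ler_pdivrMr ?kmax_gt0// kmax_ge. Qed.

(* The event kmax > x is the event that the sum of 1[L > x] is positive. *)
Lemma adapted_sum_kmax k :
  (forall phi : R -> R, measurable_fun setT phi ->
    adapted k (fun u => \sum_(L <- kakutani_lengths u k) phi L)) /\
  adapted k (fun u => kmax u k).
Proof.
have max_of_sum l : (forall phi : R -> R, measurable_fun setT phi ->
    adapted l (fun u => \sum_(L <- kakutani_lengths u l) phi L)) ->
    adapted l (fun u => kmax u l).
  move=> aphi d S V mV.
  apply: (measurability _ (RGenOInfty.measurableE R)) => //.
  move=> /= _ [_ [x ->] <-]; rewrite setTI.
  pose phi (y : R) : R := if x < y then 1 else 0.
  have mphi : measurable_fun setT phi.
    exact: measurable_fun_ifT (measurable_fun_ltr (measurable_cst _)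
      (@measurable_id _ _ _)) (measurable_cst _) (measurable_cst _).
  have := aphi _ mphi d S V mV.
  move=> /(_ measurableT `]0, +oo[%classic (measurable_itv _)).
  rewrite setTI; congr measurable; apply/seteqP; split=> z /=;
    rewrite !in_itv/= !andbT.
    move=> S0; rewrite ltNge; apply/negP => Mx; move: S0.
    rewrite big_seq big1 ?ltxx// => L /seq_max_ge LM.
    by rewrite /phi ltNge (le_trans LM Mx).
  move=> xM; rewrite (big_rem _ (kmax_mem _ _))/=.
  by rewrite {1}/phi xM ltr_pwDl// sumr_ge0// => L _; rewrite /phi; case: ifP.
(* Both claims are proved together: by [sum_kakutani], the sums at time [k.+1] are built from the
   sums and from [kmax] at time [k]. *)
elim: k => [|k [IHs IHm]].
  split.
    by move=> phi mphi d S V _ /=; under eq_fun do rewrite big_seq1;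
      exact: measurable_cst.
  by move=> d S V _; exact: (measurable_cst (seq_max [:: 1])).
suff aS : forall phi : R -> R, measurable_fun setT phi ->
    adapted k.+1 (fun u => \sum_(L <- kakutani_lengths u k.+1) phi L).
  by split=> //; exact: max_of_sum.
move=> phi mphi d S V mV.
have mV' i : (0 < i <= k)%N -> measurable_fun setT (V i).
  by move=> /andP[i0 ik]; apply: mV; rewrite i0 leqW.
have mK := IHm d S V mV'.
have mk : measurable_fun setT (V k.+1) by apply: mV; rewrite leqnn.
under eq_fun do rewrite sum_kakutani.
apply: measurable_funD; first apply: measurable_funB.
- exact: IHs.
- exact: measurableT_comp mphi mK.
- apply: measurable_funD; apply: (measurableT_comp mphi).
  + exact: measurable_funM.
  + by apply: measurable_funM => //; exact: measurable_funB.
Qed.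
End splitting.

(** * Number of cuts needed to reach a given mesh *)

Section calculus.
Context {R : realType}.
Local Notation leb := (@lebesgue_measure R).

Lemma Rintegral_deriv_poly (p : {poly R}) (a b : R) : a < b ->
  \int[leb]_(v in `[a, b]) p^`().[v] = p.[b] - p.[a].
Proof.
move=> ab; rewrite /Rintegral (@continuous_FTC2 _ _ (fun v => p.[v]))//.
- by apply: continuous_subspaceT => x; exact: continuous_horner.
- split=> [x _| |].
  + exact: derivable_horner.
  + by apply: cvg_at_right_filter; exact: continuous_horner.
  + by apply: cvg_at_left_filter; exact: continuous_horner.
- by move=> x _; rewrite -derivE.
Qed.

Lemma integrable_itv01 (f : R -> R) (K : R) : measurable_fun setT f ->
  (forall v, 0 <= v <= 1 -> `|f v| <= K) ->
  leb.-integrable `[0, 1] (EFin \o f).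
Proof.
move=> mf fK; apply: measurable_bounded_integrable => //.
- by rewrite /= lebesgue_measure_itv/= lte_fin ltr01 oppr0 adde0 ltry.
- exact: measurable_funTS.
- exists K; split; first exact: num_real.
  move=> x Kx v /=; rewrite in_itv/= => v01.
  exact: le_trans (fK v v01) (ltW Kx).
Qed.

(* Expected number of cuts needed to bring an interval of length s down to pieces
   of length at most 1. *)
Definition cuts (s : R) : R := if 1 < s then 2 * s - 1 else 0.

Lemma cuts_ge0 s : 0 <= cuts s.
Proof. by rewrite /cuts; case: ltP => //; lra. Qed.

Lemma cuts_le s : 0 <= s -> cuts s <= 2 * s.
Proof. by rewrite /cuts; case: ltP => //; lra. Qed.

Lemma measurable_cuts : measurable_fun setT cuts.
Proof.
apply: (measurable_fun_ifT (measurable_fun_ltr (measurable_cst _) (@measurable_id _ _ _))).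
  by apply: measurable_funB => //; exact: measurable_funM.
exact: measurable_cst.
Qed.

(** Change in cuts made plus expected cuts to come when an interval of rescaled length [s] is split
    at the fraction [v]; it is 0 once [s] is at most 1. *)
Definition cuts_incr (s v : R) : R :=
  if 1 < s then 1 - cuts s + (cuts (v * s) + cuts ((1 - v) * s)) else 0.

Lemma cuts_incrE s v : 0 <= s -> 0 <= v <= 1 ->
  cuts_incr s v =
  (if 1 < s then 1 else 0) - cuts s + (cuts (v * s) + cuts ((1 - v) * s)).
Proof.
move=> s0 /andP[v0 v1]; rewrite /cuts_incr; case: ltP => // s1.
rewrite /cuts !ltNge s1 /=; have -> : v * s <= 1 by nra.
have -> : (1 - v) * s <= 1 by nra.
by rewrite /=; lra.
Qed.

(** For pieces [a + b = s > 1], the increment is 0 if both exceed 1, [1 - 2 * b] if only [a] does,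
    and [2 - 2 * s] with [s <= 2] if neither does. Keeping the indicator on the right lets the
    potential absorb the square in [lyapunovS]. *)
Lemma cuts_incr_bound s v : 0 <= v <= 1 ->
  cuts_incr s v ^+ 2 <= 4 * (if 1 < s then 1 else 0).
Proof.
move=> /andP[v0 v1]; rewrite /cuts_incr; case: ltP => s1; last by lra.
suff : -2 <= 1 - cuts s + (cuts (v * s) + cuts ((1 - v) * s)) <= 2.
  by move=> /andP[? ?]; nra.
have ab : v * s + (1 - v) * s = s by lra.
have a0 : 0 <= v * s by rewrite mulr_ge0//; lra.
have b0 : 0 <= (1 - v) * s by rewrite mulr_ge0//; lra.
move: (v * s) ((1 - v) * s) ab a0 b0 => a b ab a0 b0.
by rewrite /cuts s1; case: (ltP 1 a) => ?; case: (ltP 1 b) => ?; apply/andP; split; lra.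
Qed.

Lemma measurable_cuts_comp (s : R) : measurable_fun setT (fun v : R => cuts (v * s)).
Proof.
by apply: (measurableT_comp measurable_cuts); exact: measurable_funM.
Qed.

Lemma measurable_cuts_compC (s : R) :
  measurable_fun setT (fun v : R => cuts ((1 - v) * s)).
Proof.
apply: (measurableT_comp measurable_cuts); apply: measurable_funM => //.
exact: measurable_funB.
Qed.

Lemma measurable_cuts_incr (s : R) : measurable_fun setT (cuts_incr s).
Proof.
rewrite /cuts_incr; case: ltP => _; last exact: measurable_cst.
apply: measurable_funD => //; apply: measurable_funD.
  exact: measurable_cuts_comp.
exact: measurable_cuts_compC.
Qed.

Lemma integrable_poly (p : {poly R}) (a b : R) :
  leb.-integrable `[a, b] (EFin \o (fun v => p.[v])).
Proof.
apply: continuous_compact_integrable; first exact: segment_compact.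
by apply: continuous_subspaceT => x; exact: continuous_horner.
Qed.

(** Serves integrands that are polynomial on a subinterval and 0 outside. The flags [b0] and [b1]
    cover open and closed ends, since strict inequalities between lengths produce both. *)
Lemma Rintegral_itv01_deriv_poly (f : R -> R) (p : {poly R}) (b0 b1 : bool) (a b : R) :
  0 <= a -> a < b -> b <= 1 ->
  (forall v, 0 <= v <= 1 ->
    f v = if v \in Interval (BSide b0 a) (BSide b1 b) then p^`().[v] else 0) ->
  \int[leb]_(v in `[0, 1]) f v = p.[b] - p.[a].
Proof.
move=> a0 ab b_le1 fE.
rewrite -Rintegral_deriv_poly//.
have -> : \int[leb]_(v in `[0, 1]) f v =
   \int[leb]_(v in `[0, 1] `&` [set` Interval (BSide b0 a) (BSide b1 b)]) p^`().[v].
  rewrite Rintegral_mkcondr; apply: eq_Rintegral => v; rewrite inE/= in_itv/=.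
  by move=> v01; rewrite patchE fE// mem_setE.
have ip := integrable_poly p^`() a b.
have sub (c0 c1 : bool) : [set` Interval (BSide c0 a) (BSide c1 b)] `<=` `[a, b]%classic.
  by move=> v; case: c0; case: c1; rewrite /= !in_itv/= => /andP[? ?];
     apply/andP; split => //; exact: ltW.
have -> : `[0, 1]%classic `&` [set` Interval (BSide b0 a) (BSide b1 b)] =
    [set` Interval (BSide b0 a) (BSide b1 b)].
  apply/setIidr => v /sub; rewrite /= !in_itv/= => /andP[av vb].
  by rewrite (le_trans a0 av) (le_trans vb b_le1).
have ipc (c0 c1 : bool) : leb.-integrable [set` Interval (BSide c0 a) (BSide c1 b)]
    (EFin \o (fun v => p^`().[v])).
  by apply: integrableS ip => //; exact: measurable_itv.
case: b0 fE => _; case: b1 => //.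
- by rewrite Rintegral_itv_bndo_bndc.
- by rewrite Rintegral_itv_obnd_cbnd// Rintegral_itv_bndo_bndc.
- by rewrite Rintegral_itv_obnd_cbnd.
Qed.

Lemma Rintegral_cuts (s : R) : 1 < s ->
  \int[leb]_(v in `[0, 1]) cuts (v * s) = s - 1.
Proof.
move=> s1; have s0 : 0 < s by lra.
have sV1 : s^-1 < 1 by rewrite invf_lt1.
have sV0 : 0 < s^-1 by rewrite invr_gt0.
(* The antiderivative of [2 * (v * s) - 1]; it vanishes at [s^-1], where the support starts. *)
rewrite (@Rintegral_itv01_deriv_poly _ (s *: 'X^2 - 'X) false false s^-1 1)//; last 2 first.
- exact: ltW.
- move=> v /andP[v0 v1]; rewrite in_itv/= v1 andbT /cuts -ltr_pdivrMr// mul1r.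
  by case: ifP => // _; rewrite !poly.derivE !hornerE /=; lra.
by rewrite !hornerE /=; field; lra.
Qed.

Lemma Rintegral_cutsC (s : R) : 1 < s ->
  \int[leb]_(v in `[0, 1]) cuts ((1 - v) * s) = s - 1.
Proof.
move=> s1; have s0 : 0 < s by lra.
have sV1 : s^-1 < 1 by rewrite invf_lt1.
have sV0 : 0 < s^-1 by rewrite invr_gt0.
rewrite (@Rintegral_itv01_deriv_poly _ ((2 * s - 1) *: 'X - s *: 'X^2)
  true true 0 (1 - s^-1))//; last 3 first.
- by lra.
- by lra.
- move=> v /andP[v0 v1]; rewrite in_itv/= v0 /= /cuts -ltr_pdivrMr// mul1r.
  have -> : (s^-1 < 1 - v) = (v < 1 - s^-1) by apply/idP/idP; lra.
  by case: ifP => // _; rewrite !poly.derivE !hornerE /=; lra.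
by rewrite !hornerE /=; field; lra.
Qed.

(** The martingale property: for [s > 1] it reads [1 - (2 * s - 1) + 2 * (s - 1) = 0], which is the
    recursion solved by [cuts]. *)
Lemma Rintegral_cuts_incr (s : R) :
  \int[leb]_(v in `[0, 1]) cuts_incr s v = 0.
Proof.
rewrite /cuts_incr; case: ltP => s1; last first.
  by rewrite Rintegral_cst// mul0r.
have bnd v : 0 <= v <= 1 -> `|cuts (v * s)| <= 2 * s.
  move=> /andP[v0 v1]; rewrite ger0_norm ?cuts_ge0//.
  by apply: (le_trans (cuts_le _)); nra.
have i1 : leb.-integrable `[0, 1] (EFin \o (fun v => cuts (v * s))).
  exact: integrable_itv01 (measurable_cuts_comp s) bnd.
have i2 : leb.-integrable `[0, 1] (EFin \o (fun v => cuts ((1 - v) * s))).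
  apply: integrable_itv01 (measurable_cuts_compC s) _ => v v01.
  by apply: bnd; lra.
have ic : leb.-integrable `[0, 1] (EFin \o (fun=> 1 - cuts s)).
  by apply: (@integrable_itv01 _ `|1 - cuts s|) => //; exact: measurable_cst.
have i12 : leb.-integrable `[0, 1]
    (EFin \o (fun v => cuts (v * s) + cuts ((1 - v) * s))).
  have := integrableD _ i1 i2; apply; exact: measurable_itv.
rewrite RintegralD// RintegralD// Rintegral_cuts// Rintegral_cutsC//.
rewrite Rintegral_cst//= lebesgue_measure_itv/= lte_fin ltr01 oppr0 adde0 /cuts s1 /=.
by lra.
Qed.
End calculus.

(** * Linearity and monotonicity of the expectation *)

Section expectation_theory.
Context {d : measure_display} {T : measurableType d} {R : realType}.
Variables (P : probability T R) (U : nat -> T -> R).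
Hypothesis uU : forall i, uniform01 P (U i).

Lemma expect_cst c : expect P U (fun=> c) = c.
Proof. by rewrite /expect Rintegral_cst//= probability_setT mulr1. Qed.

Lemma expectD k H1 H2 : bounded_adapted k H1 -> bounded_adapted k H2 ->
  expect P U (fun u => H1 u + H2 u) = expect P U H1 + expect P U H2.
Proof.
by move=> b1 b2; rewrite /expect RintegralD//;
  [exact: (integrable_drive uU b1)|exact: (integrable_drive uU b2)].
Qed.

Lemma expectZ k c H : bounded_adapted k H ->
  expect P U (fun u => c * H u) = c * expect P U H.
Proof. by move=> b; rewrite /expect RintegralZl//; exact: (integrable_drive uU b). Qed.

Lemma expectN k H : bounded_adapted k H -> expect P U (fun u => - H u) = - expect P U H.
Proof.
move=> bH; rewrite -mulN1r -(expectZ _ bH); congr expect.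
by apply/funext => u; rewrite mulN1r.
Qed.

Lemma le_expect k H1 H2 : bounded_adapted k H1 -> bounded_adapted k H2 ->
  (forall u, unit_seq u -> H1 u <= H2 u) -> expect P U H1 <= expect P U H2.
Proof.
move=> b1 b2 H12; apply: le_Rintegral => //.
- exact: (integrable_drive uU b1).
- exact: (integrable_drive uU b2).
- by move=> w _; apply: H12; exact: unit_seq_drive.
Qed.

Lemma expect_sum k n (H : 'I_n -> (nat -> R) -> R) :
  (forall i, bounded_adapted k (H i)) ->
  expect P U (fun u => \sum_(i < n) H i u) = \sum_(i < n) expect P U (H i).
Proof.
elim: n H => [|n IHn] H bH.
  rewrite big_ord0 -[RHS](expect_cst 0); congr expect.
  by apply/funext => u; rewrite big_ord0.
rewrite big_ord_recr/= -IHn// -(expectD (k := k))//; last first.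
  exact: bounded_adapted_sum.
by congr expect; apply/funext => u; rewrite big_ord_recr.
Qed.
End expectation_theory.

(** * Variance of the number of cuts *)

Section variance.
Context {R : realType}.
Implicit Types u : nat -> R.
Local Notation leb := (@lebesgue_measure R).

Lemma measurable_invr : measurable_fun setT (@GRing.inv R).
Proof.
have m0 : measurable_fun ([set 0] : set R) (@GRing.inv R).
  apply: (eq_measurable_fun (cst 0 : R -> R)); last exact: measurable_cst.
  by move=> x; rewrite inE => ->; rewrite invr0.
have mC : measurable_fun (~` [set 0] : set R) (@GRing.inv R).
  rewrite (_ : ~` _ = [set x | x != 0]); last first.
    by apply/seteqP; split=> x /= /eqP.
  apply: open_continuous_measurable_fun; first exact: open_neq.
  by move=> x; rewrite inE => x0; exact: inv_continuous.
rewrite -(setUv [set 0 : R]).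
by apply: (iffRL (measurable_funU _ _ _) (conj m0 mC)) => //; exact: measurableC.
Qed.

Lemma bounded_adapted_inv_kmax k : bounded_adapted k (fun u => (kmax u k)^-1).
Proof.
split.
  move=> d S V mV; apply: (measurableT_comp measurable_invr).
  exact: (adapted_sum_kmax k).2.
by exists k.+1%:R => u u01; rewrite ger0_norm ?inv_kmax_le// invr_ge0 ltW// kmax_gt0.
Qed.

(** Indicator that cut [j.+1] is still needed to bring all lengths down to at most [1 / i]. *)
Definition is_big (i : nat) u j : R := if 1 < i%:R * kmax u j then 1 else 0.
Definition num_big i u k := \sum_(j < k) is_big i u j.
Definition potential (i : nat) u k :=
  \sum_(L <- kakutani_lengths u k) cuts (i%:R * L).
(* The conditional expectation, given the first k cuts, of the number of cuts needed
   to make all lengths at most 1/i. *)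
Definition num_cuts i u k := num_big i u k + potential i u k.
(* The potential pays for the variance of the cuts still to come, which makes this a
   supermartingale. *)
Definition lyapunov (i : nat) u k :=
  (num_cuts i u k - cuts i%:R) ^+ 2 + 4 * potential i u k.

Lemma bounded_adapted_is_big i k : bounded_adapted k (fun u => is_big i u k).
Proof.
split; last by exists 1 => u _; rewrite /is_big; case: ifP; rewrite ?normr1 ?normr0.
move=> d S V mV.
apply: (measurable_fun_ifT (measurable_fun_ltr (measurable_cst _) _)) => //.
by apply: measurable_funM => //; exact: (adapted_sum_kmax k).2.
Qed.

Lemma potential_ge0 i u k : 0 <= potential i u k.
Proof. by apply: sumr_ge0 => L _; exact: cuts_ge0. Qed.

Lemma potential_le i u k : unit_seq u -> potential i u k <= 2 * i%:R.
Proof.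
move=> u01; rewrite -[leRHS]mulr1 -[X in _ * X](sum_kakutani_lengths u k) mulr_sumr.
rewrite /potential big_seq [leRHS]big_seq; apply: ler_sum => L Ls.
rewrite -mulrA; apply: cuts_le; rewrite mulr_ge0//.
exact: kakutani_length_ge0 Ls.
Qed.

Lemma bounded_adapted_potential i k : bounded_adapted k (fun u => potential i u k).
Proof.
split; last first.
  by exists (2 * i%:R) => u u01; rewrite ger0_norm ?potential_ge0// potential_le.
apply: (adapted_sum_kmax k).1; apply: (measurableT_comp measurable_cuts).
exact: measurable_funM.
Qed.

Lemma bounded_adapted_num_cuts i k : bounded_adapted k (fun u => num_cuts i u k).
Proof.
apply: bounded_adaptedD; last exact: bounded_adapted_potential.
apply: bounded_adapted_sum => j.
exact: bounded_adaptedW (ltnW (ltn_ord j)) (bounded_adapted_is_big i j).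
Qed.

Lemma bounded_adapted_lyapunov i k : bounded_adapted k (fun u => lyapunov i u k).
Proof.
apply: bounded_adaptedD.
  apply/bounded_adapted_sqr/bounded_adaptedB; last exact: bounded_adapted_cst.
  exact: bounded_adapted_num_cuts.
by apply: bounded_adaptedM; [exact: bounded_adapted_cst|exact: bounded_adapted_potential].
Qed.

Lemma potentialS i u k : unit_seq u ->
  potential i u k.+1 =
  potential i u k + cuts_incr (i%:R * kmax u k) (u k.+1) - is_big i u k.
Proof.
move=> u01; rewrite cuts_incrE//; last by rewrite mulr_ge0// ltW// kmax_gt0.
rewrite /potential (sum_kakutani (fun L => cuts (i%:R * L))) /is_big.
by rewrite !(mulrCA i%:R); case: ifP => _; ring.
Qed.

Lemma num_cutsS i u k : unit_seq u ->
  num_cuts i u k.+1 = num_cuts i u k + cuts_incr (i%:R * kmax u k) (u k.+1).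
Proof.
move=> u01; rewrite /num_cuts potentialS// /num_big big_ord_recr /=; lra.
Qed.

(** Let [D] be the increment. Expanding the square leaves [D ^+ 2], at most four times the indicator
    [is_big], and the drop of [4 * potential] cancels this. What remains is linear in [D], with a
    coefficient fixed by the past. *)
Lemma lyapunovS i u k : unit_seq u ->
  lyapunov i u k.+1 <= lyapunov i u k +
    (2 * (num_cuts i u k - cuts i%:R) + 4) * cuts_incr (i%:R * kmax u k) (u k.+1).
Proof.
move=> u01; rewrite /lyapunov num_cutsS// potentialS// /is_big.
have := cuts_incr_bound (i%:R * kmax u k) (u01 k.+1).
set D := cuts_incr _ _; set b := (if _ then _ else _).
move: (num_cuts i u k) (potential i u k) (cuts i%:R) => X p c; nra.
Qed.

Lemma is_big_upd i u k j v : (j <= k)%N -> is_big i (upd u k.+1 v) j = is_big i u j.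
Proof. by move=> jk; rewrite /is_big kmax_upd. Qed.

Lemma potential_upd i u k v : potential i (upd u k.+1 v) k = potential i u k.
Proof. by rewrite /potential kakutani_lengths_upd. Qed.

Lemma num_cuts_upd i u k v : num_cuts i (upd u k.+1 v) k = num_cuts i u k.
Proof.
rewrite /num_cuts potential_upd; congr (_ + _); apply: eq_bigr => j _.
by rewrite is_big_upd// ltnW.
Qed.

Lemma lyapunov_step i u k : unit_seq u ->
  \int[leb]_(v in `[0, 1]) lyapunov i (upd u k.+1 v) k.+1 <= lyapunov i u k.
Proof.
move=> u01; set B := 2 * (num_cuts i u k - cuts i%:R) + 4.
pose D v := cuts_incr (i%:R * kmax u k) v.
have iD : leb.-integrable `[0, 1] (EFin \o D).
  apply: (@integrable_itv01 _ D 2); first exact: measurable_cuts_incr.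
  move=> v v01; have := cuts_incr_bound (i%:R * kmax u k) v01.
  rewrite -/(D v) => h; rewrite ler_norml; move: h.
  by case: ifP => _ h; apply/andP; split; nra.
have iBD : leb.-integrable `[0, 1] (EFin \o (fun v => B * D v)).
  have mI : measurable (`[0, 1]%classic : set (measurableTypeR R)).
    exact: measurable_itv.
  by have := integrableZl mI B iD; apply: eq_integrable.
have ic : leb.-integrable `[0, 1] (EFin \o (fun=> lyapunov i u k)).
  exact: (integrable_coord (k := 0) u01 (bounded_adapted_cst 0 _)).
(* The term linear in the increment has mean 0 by [Rintegral_cuts_incr]. *)
have -> : lyapunov i u k = \int[leb]_(v in `[0, 1]) (lyapunov i u k + B * D v).
  rewrite RintegralD// RintegralZl// Rintegral_cuts_incr mulr0 addr0.
  by rewrite Rintegral_cst//= lebesgue_measure_itv/= lte_fin ltr01 oppr0 adde0 mulr1.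
apply: le_Rintegral => //.
- exact: integrable_coord u01 (bounded_adapted_lyapunov i k.+1).
- have := integrableD _ ic iBD; apply; exact: measurable_itv.
- move=> v /=; rewrite in_itv/= => v01.
  have := lyapunovS i k (unit_seq_upd k.+1 u01 v01).
  rewrite num_cuts_upd kmax_upd// upd_same.
  by rewrite /lyapunov num_cuts_upd potential_upd.
Qed.

(** At time 0 the square vanishes and [4 * cuts i%:R <= 8 * i%:R] is left; afterwards the
    expectation does not increase. *)
Lemma expect_lyapunov (d : measure_display) (T : measurableType d)
    (P : probability T R) (U : nat -> T -> R) i n :
  (forall i, uniform01 P (U i)) -> mutually_independent P U ->
  expect P U (fun u => lyapunov i u n) <= 8 * i%:R.
Proof.
move=> uU iU; elim: n => [|n IHn].
  have -> : expect P U (fun u => lyapunov i u 0) = lyapunov i (fun=> 0) 0.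
    rewrite -[RHS](expect_cst P U); congr expect; apply/funext => u.
    by rewrite /lyapunov /num_cuts /num_big !big_ord0.
  rewrite /lyapunov /num_cuts /num_big /potential /= big_ord0 big_seq1 mulr1.
  rewrite add0r subrr; have := @cuts_le R i%:R (ler0n _ _); lra.
apply: le_trans IHn.
apply: (expect_le_step uU iU (k := n)).
- exact: bounded_adapted_lyapunov.
- exact: bounded_adapted_lyapunov.
- by move=> u u01; exact: lyapunov_step.
Qed.
End variance.

(** * Discounted survival *)

Section survival.
Context {R : realType}.
Variables (x y : R).
Hypotheses (x_ge0 : 0 <= x) (y_ge0 : 0 <= y).
Implicit Types u : nat -> R.
Local Notation leb := (@lebesgue_measure R).

(** The conditional probability that the next cut creates a piece of length at most [y], before
    capping at 1; the cap reappears as [Num.max 0 (1 - hazard u k)]. *)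
Definition hazard u k : R := 2 * y / kmax u k.

Fixpoint remaining u k : R :=
  if k is k'.+1 then Num.max 0 (remaining u k' - hazard u k') else x.

Definition alive u k : R :=
  if all (fun L => y < L) (kakutani_lengths u k) then 1 else 0.

Definition discounted u k : R := alive u k * expR (- remaining u k).

Definition step_error u k : R :=
  hazard u k ^+ 2 + Num.max 0 (hazard u k - remaining u k).

Lemma hazard_ge0 u k : 0 <= hazard u k.
Proof. by rewrite divr_ge0 ?mulr_ge0// ltW// kmax_gt0. Qed.

Lemma remaining_ge0 u k : 0 <= remaining u k.
Proof. by case: k => //= k; rewrite le_max lexx. Qed.

(** Since the hazards are nonnegative, truncating at every step amounts to truncating once at the
    end. *)
Lemma remainingE u k : remaining u k = Num.max 0 (x - \sum_(j < k) hazard u j).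
Proof.
elim: k => [|k IHk]; first by rewrite big_ord0 subr0 /= max_r.
rewrite /= IHk big_ord_recr /=; have := hazard_ge0 u k.
move: (hazard u k) (\sum_(j < k) _) => q s q0.
have -> : x - (s + q) = x - s - q by lra.
by case: (lerP 0 (x - s)) => // ?; rewrite !max_l//; lra.
Qed.

(** Telescoping of [Num.max 0 (q - r) = Num.max 0 (r - q) - r + q]. *)
Lemma sum_overshoot u k : \sum_(j < k) Num.max 0 (hazard u j - remaining u j) =
  remaining u k + \sum_(j < k) hazard u j - x.
Proof.
elim: k => [|k IHk]; first by rewrite !big_ord0 /=; lra.
rewrite !big_ord_recr /= IHk.
move: (remaining u k) (hazard u k) => r q.
case: (lerP 0 (r - q)) => rq; first by rewrite max_l; lra.
by rewrite max_r; lra.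
Qed.

(** If [q <= r], factor out [expR (- r)] and use [1 - q ^+ 2 <= (1 - q) * expR q <= 1] while
    [q <= 1]. If [r < q], the new exponent is 0 and [1 - r <= expR (- r) <= 1 - r + r ^+ 2]
    suffices. For [q > 1] the bound [1 <= q ^+ 2] is enough. *)
Lemma discount_error (r q : R) : 0 <= r -> 0 <= q ->
  `|Num.max 0 (1 - q) * expR (- Num.max 0 (r - q)) - expR (- r)| <=
  q ^+ 2 + Num.max 0 (q - r).
Proof.
move=> r0 q0.
have Er1 : expR (- r) <= 1 by rewrite -expR0 ler_expR; lra.
have Er0 : 0 < expR (- r) by exact: expR_gt0.
have Er : 1 - r <= expR (- r) by have := expR_ge1Dx (- r); lra.
have [qr|rq] := leP q r.
  rewrite (max_r (_ : 0 <= r - q)); last by lra.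
  rewrite (max_l (_ : q - r <= 0)); last by lra.
  rewrite (_ : - (r - q) = q + - r); last by lra.
  rewrite expRD mulrA -{2}[expR (- r)]mul1r -mulrBl normrM (ger0_norm (ltW Er0)).
  have Eq : 1 + q <= expR q := expR_ge1Dx q.
  have Eq0 : 0 < expR q by exact: expR_gt0.
  have Eqq : (1 - q) * expR q <= 1.
    have := expR_ge1Dx (- q) => h.
    have : expR (- q) * expR q = 1 by rewrite -expRD addNr expR0.
    nra.
  suff : `|Num.max 0 (1 - q) * expR q - 1| <= q ^+ 2.
    by have := normr_ge0 (Num.max 0 (1 - q) * expR q - 1); nra.
  rewrite ler_norml; case: (lerP 0 (1 - q)) => q1; first by apply/andP; split; nra.
  by rewrite mul0r; apply/andP; split; nra.
rewrite (max_l (_ : r - q <= 0)); last by lra.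
rewrite (max_r (_ : 0 <= q - r)); last by lra.
rewrite oppr0 expR0 mulr1 ler_norml.
have Er2 : expR (- r) * (1 + r) <= 1.
  have : expR (- r) * expR r = 1 by rewrite -expRD addNr expR0.
  by have := expR_ge1Dx r; nra.
have Er3 : expR (- r) <= 1 - r + r ^+ 2.
  have : expR (- r) * (1 + r) <= (1 - r + r ^+ 2) * (1 + r) by nra.
  by rewrite ler_pM2r//; lra.
by case: (lerP 0 (1 - q)) => q1; apply/andP; split; nra.
Qed.

Lemma aliveS u k : unit_seq u ->
  alive u k.+1 = alive u k *
    (if (y < u k.+1 * kmax u k) && (y < (1 - u k.+1) * kmax u k) then 1 else 0).
Proof.
move=> u01; rewrite /alive.
have := perm_all (fun L => y < L) (perm_kakutani u k).
move: (kakutani_lengths u k.+1) (kmax_mem u k.+1) => s' Ms'.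
rewrite /= [RHS in _ = RHS -> _]andbA.
case: (boolP (all _ (kakutani_lengths u k))) => [/allP als|nals].
  by rewrite als ?kmax_mem// andTb andbT => ->; rewrite mul1r.
(* Some length is already at most [y]. If the longest exceeds [y], that short interval is not the
   one cut and persists; otherwise the new longest is at most [y] too, by [kmax_le]. *)
rewrite andbF mul0r; case: (ltP y (kmax u k)) => [_ /= ->//|My _].
case: allP => // als'; have := als' _ Ms'.
by rewrite ltNge (le_trans (kmax_le _ u01) My).
Qed.

(** Both pieces exceed [y] exactly for [v] in []y / M, 1 - y / M[], which is empty once
    [M <= 2 * y]. *)
Lemma Rintegral_no_short_piece (M : R) : 0 < M ->
  \int[leb]_(v in `[0, 1])
    (if (y < v * M) && (y < (1 - v) * M) then 1 else 0) =
  Num.max 0 (1 - 2 * y / M).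
Proof.
move=> M0; have yM : 0 <= y / M by rewrite divr_ge0// ltW.
have condE v : (y < v * M) && (y < (1 - v) * M) = (v \in `]y / M, 1 - y / M[).
  rewrite in_itv/= -!ltr_pdivrMr//; congr (_ && _).
  by apply/idP/idP; lra.
have [le|lt] := leP (1 - y / M) (y / M).
  rewrite max_l; last by lra.
  rewrite (eq_Rintegral _ (g := fun=> 0)); first by rewrite Rintegral_cst// mul0r.
  move=> v _; rewrite condE in_itv/=; case: ifP => // /andP[? ?]; lra.
rewrite max_r; last by lra.
rewrite (@Rintegral_itv01_deriv_poly _ _ 'X false true (y / M) (1 - y / M))//.
- by rewrite !hornerX; lra.
- by lra.
- by move=> v _; rewrite condE derivX hornerC.
Qed.

Lemma hazard_upd u k j v : (j <= k)%N -> hazard (upd u k.+1 v) j = hazard u j.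
Proof. by move=> jk; rewrite /hazard kmax_upd. Qed.

Lemma remaining_upd u k j v : (j <= k.+1)%N ->
  remaining (upd u k.+1 v) j = remaining u j.
Proof.
by elim: j => //= j IHj jk; rewrite IHj ?(ltnW jk)// hazard_upd.
Qed.

Lemma alive_upd u k v : alive (upd u k.+1 v) k = alive u k.
Proof. by rewrite /alive kakutani_lengths_upd. Qed.

Lemma bounded_adapted_hazard k : bounded_adapted k (fun u => hazard u k).
Proof.
by apply: bounded_adaptedM; [exact: bounded_adapted_cst|exact: bounded_adapted_inv_kmax].
Qed.

Lemma bounded_adapted_remaining k : bounded_adapted k (fun u => remaining u k).
Proof.
elim: k => [|k IHk]; first exact: bounded_adapted_cst.
apply: bounded_adapted_max; first exact: bounded_adapted_cst.
apply: (bounded_adaptedW (leqnSn k)); apply: bounded_adaptedB => //.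
exact: bounded_adapted_hazard.
Qed.

Lemma bounded_adapted_alive k : bounded_adapted k (fun u => alive u k).
Proof.
split; last by exists 1 => u _; rewrite /alive; case: ifP; rewrite ?normr1 ?normr0.
(* [phi] marks the lengths that are at most [y]. Survival means that their number is below 1, so
   [adapted_sum_kmax] gives measurability. *)
pose phi (L : R) : R := if y < L then 0 else 1.
have mphi : measurable_fun setT phi.
  exact: measurable_fun_ifT (measurable_fun_ltr (measurable_cst _)
    (@measurable_id _ _ _)) (measurable_cst _) (measurable_cst _).
have aliveE u : alive u k =
    if \sum_(L <- kakutani_lengths u k) phi L < 1 then 1 else 0.
  rewrite /alive; congr (if _ then _ else _).
  elim: (kakutani_lengths u k) => [|L s IHs]; first by rewrite big_nil ltr01.
  rewrite /= big_cons IHs [phi L]/phi; case: (y < L); first by rewrite add0r.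
  apply/esym/negbTE; rewrite -leNgt lerDl sumr_ge0// => z _.
  by rewrite /phi; case: ifP.
move=> d S V mV; under eq_fun do rewrite aliveE.
apply: (measurable_fun_ifT (measurable_fun_ltr _ (measurable_cst _))) => //.
exact: (adapted_sum_kmax k).1.
Qed.

Lemma bounded_adapted_discounted k : bounded_adapted k (fun u => discounted u k).
Proof.
apply: bounded_adaptedM; first exact: bounded_adapted_alive.
split.
  move=> d S V mV; apply: (measurableT_comp (@measurable_expR R)).
  apply: (measurableT_comp (@oppr_measurable R setT)).
  exact: (bounded_adapted_remaining k).1.
exists 1 => u _; rewrite ger0_norm ?expR_ge0// -expR0 ler_expR.
by rewrite lerNl oppr0 remaining_ge0.
Qed.

Lemma bounded_adapted_step_error k : bounded_adapted k (fun u => step_error u k).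
Proof.
apply: bounded_adaptedD.
  by apply: bounded_adapted_sqr; exact: bounded_adapted_hazard.
apply: bounded_adapted_max; first exact: bounded_adapted_cst.
apply: bounded_adaptedB; [exact: bounded_adapted_hazard|exact: bounded_adapted_remaining].
Qed.

(** [remaining u k.+1] only involves hazards at times up to [k], so it is constant while cut [k.+1]
    is averaged. *)
Lemma Rintegral_discounted u k : unit_seq u ->
  \int[leb]_(v in `[0, 1]) discounted (upd u k.+1 v) k.+1 =
  alive u k * (Num.max 0 (1 - hazard u k) * expR (- remaining u k.+1)).
Proof.
move=> u01; have M0 := kmax_gt0 u k.
rewrite /hazard -Rintegral_no_short_piece//.
rewrite mulrA mulrAC.
rewrite -RintegralZl//; last first.
  apply: (@integrable_itv01 _ _ 1).
    apply: measurable_fun_ifT => //.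
    apply: measurable_and; apply: measurable_fun_ltr => //.
      exact: measurable_funM.
    by apply: measurable_funM => //; exact: measurable_funB.
  by move=> v _; case: ifP; rewrite ?normr1 ?normr0.
apply: eq_Rintegral => v; rewrite inE/= in_itv/= => v01.
rewrite /discounted aliveS; last exact: unit_seq_upd.
by rewrite alive_upd kmax_upd// upd_same remaining_upd// mulrAC.
Qed.

Lemma discounted_step u k : unit_seq u ->
  `|\int[leb]_(v in `[0, 1]) discounted (upd u k.+1 v) k.+1 - discounted u k| <=
  step_error u k.
Proof.
move=> u01; rewrite Rintegral_discounted// /discounted /step_error -mulrBr normrM.
have := discount_error (remaining_ge0 u k) (hazard_ge0 u k).
set a := `|_|; set b := _ + _ => ab; have a0 : 0 <= a by exact: normr_ge0.
have : 0 <= `|alive u k| <= 1.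
  by rewrite /alive; case: ifP => _; rewrite ?normr1 ?normr0 ?lexx ?ler01.
by move=> /andP[? ?]; nra.
Qed.

Context (d : measure_display) (T : measurableType d).
Context (P : probability T R) (U : nat -> T -> R).
Hypotheses (uU : forall i, uniform01 P (U i)) (iU : mutually_independent P U).
Local Notation E := (expect P U).

(** The initial value is [expR (- x)], the unit interval being longer than [y]. The drift bounds
    then add up over time. *)
Lemma expect_discounted n : y < 1 ->
  `|E (fun u => discounted u n) - expR (- x)| <=
  E (fun u => \sum_(k < n) step_error u k).
Proof.
move=> y1; elim: n => [|n IHn].
  have -> : E (fun u => discounted u 0) = expR (- x).
    rewrite -[RHS](expect_cst P U); congr expect; apply/funext => u.
    by rewrite /discounted /alive /= y1 mul1r.
  rewrite subrr normr0 -[leLHS](expect_cst P U).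
  apply: (le_expect uU (k := 0)); first exact: bounded_adapted_cst.
    by apply: bounded_adapted_sum; case.
  by move=> u _; rewrite big_ord0.
have berr (k : 'I_n) : bounded_adapted n (fun u => step_error u k).
  exact: bounded_adaptedW (ltnW (ltn_ord k)) (bounded_adapted_step_error k).
have bsum : bounded_adapted n (fun u => \sum_(k < n) step_error u k).
  exact: bounded_adapted_sum.
have bd := bounded_adapted_discounted.
have be := bounded_adapted_step_error.
have -> : E (fun u => \sum_(k < n.+1) step_error u k) =
    E (fun u => \sum_(k < n) step_error u k) + E (fun u => step_error u n).
  rewrite -(expectD uU bsum (be n)); congr expect; apply/funext => u.
  by rewrite big_ord_recr.
have up : E (fun u => discounted u n.+1) <=
    E (fun u => discounted u n + step_error u n).
  apply: (expect_le_step uU iU (k := n)) => //; first exact: bounded_adaptedD.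
  by move=> u u01; have := discounted_step n u01; rewrite ler_norml; lra.
(* [expect_le_step] is one-sided, so the lower bound comes from applying it to the negative. *)
have down : E (fun u => - discounted u n.+1) <=
    E (fun u => - discounted u n + step_error u n).
  apply: (expect_le_step uU iU (k := n)).
  - exact: bounded_adaptedN.
  - by apply: bounded_adaptedD => //; exact: bounded_adaptedN.
  move=> u u01; have := discounted_step n u01.
  have -> : \int[leb]_(v in `[0, 1]) - discounted (upd u n.+1 v) n.+1 =
      - \int[leb]_(v in `[0, 1]) discounted (upd u n.+1 v) n.+1.
    rewrite -mulN1r -RintegralZl//; last exact: (integrable_coord u01 (bd n.+1)).
    by apply: eq_Rintegral => v _; rewrite mulN1r.
  by rewrite ler_norml; lra.
move: up down IHn; rewrite (expectD uU (bd n) (be n)).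
rewrite (expectD uU (bounded_adaptedN (bd n)) (be n)).
rewrite !(expectN uU (bd _)) !ler_norml; lra.
Qed.

(** Dropping the discount costs at most [remaining u n], by [1 - expR (- r) <= r]. With [S] the sum
    of the hazards and [r] the positive part of [x - S], the overshoots and this cost add up to
    [2 * r + S - x], the absolute value of [S - x]. *)
Lemma expect_alive n : y < 1 ->
  `|E (fun u => alive u n) - expR (- x)| <=
  E (fun u => \sum_(k < n) hazard u k ^+ 2 + `|\sum_(k < n) hazard u k - x|).
Proof.
move=> y1; have := expect_discounted n y1.
have bsum : bounded_adapted n (fun u => \sum_(k < n) step_error u k).
  apply: bounded_adapted_sum => k.
  exact: bounded_adaptedW (ltnW (ltn_ord k)) (bounded_adapted_step_error k).
have bd := bounded_adapted_discounted n.
have ba := bounded_adapted_alive n.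
have br := bounded_adapted_remaining n.
have totE u : \sum_(k < n) hazard u k ^+ 2 + `|\sum_(k < n) hazard u k - x| =
    \sum_(k < n) step_error u k + remaining u n.
  rewrite big_split/= sum_overshoot remainingE -addrA; congr (_ + _).
  set s := \sum_(k < n) _; case: (lerP 0 (x - s)) => ?.
    by rewrite ler0_norm; lra.
  by rewrite ger0_norm; lra.
have -> : E (fun u => \sum_(k < n) hazard u k ^+ 2 + `|\sum_(k < n) hazard u k - x|) =
    E (fun u => \sum_(k < n) step_error u k) + E (fun u => remaining u n).
  by rewrite -(expectD uU bsum br); congr expect; apply/funext.
have le1 : E (fun u => discounted u n) <= E (fun u => alive u n).
  apply: (le_expect uU bd ba) => u u01; rewrite /discounted.
  have : expR (- remaining u n) <= 1.
    by rewrite -expR0 ler_expR; have := remaining_ge0 u n; lra.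
  by rewrite /alive; case: ifP => _; rewrite ?mul0r ?mul1r.
have : E (fun u => alive u n) <= E (fun u => discounted u n + remaining u n).
  apply: (le_expect uU ba (bounded_adaptedD bd br)) => u u01; rewrite /discounted.
  have := expR_ge1Dx (- remaining u n); have := remaining_ge0 u n.
  by rewrite /alive; case: ifP => _; rewrite ?mul0r ?mul1r; lra.
rewrite (expectD uU bd br) => le2; rewrite !ler_norml; lra.
Qed.
End survival.

(** * The sum of the inverse maximal lengths *)

Section comparison.
Context {R : realType}.
Implicit Types u : nat -> R.

(** The sum is the integer part of [p]. *)
Lemma sum_indic_le n (p : R) : 0 <= p <= n%:R ->
  p - 1 <= \sum_(i < n) (if i.+1%:R <= p then 1 else 0) <= p.
Proof.
move=> /andP[p0]; elim: n => [|n IHn] pn.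
  by rewrite big_ord0; move: pn; lra.
rewrite big_ord_recr /=; have [pn'|np] := leP p n%:R.
  rewrite ifF ?addr0 ?IHn//; apply/negbTE; rewrite -ltNge (le_lt_trans pn')//.
  by rewrite ltr_nat.
rewrite (eq_bigr (fun=> 1)); last first.
  by move=> i _; rewrite ifT// (le_trans _ (ltW np))// ler_nat.
rewrite sumr_const card_ord; move: pn; rewrite -natr1.
by case: ifP => [h|/negbT]; rewrite -?ltNge => *; apply/andP; split; lra.
Qed.

Lemma one_sub_is_big i u j :
  1 - is_big i.+1 u j = if i.+1%:R <= (kmax u j)^-1 then 1 else 0 :> R.
Proof.
have -> : (i.+1%:R <= (kmax u j)^-1) = ~~ (1 < i.+1%:R * kmax u j).
  by rewrite -leNgt -[in RHS]ler_pdivlMr ?kmax_gt0// div1r.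
by rewrite /is_big; case: (1 < _); rewrite /= ?subrr ?subr0.
Qed.

(** If a length above [1 / i] remains at time [n], all [n] cuts were counted and both sides are 0.
    Otherwise the potential is 0, and [num_cuts] equals [num_big], which is at most [n]. *)
Lemma sub_num_big i u n : unit_seq u ->
  n%:R - num_big i u n = Num.max 0 (n%:R - num_cuts i u n).
Proof.
move=> u01; rewrite /num_cuts; have := potential_ge0 i u n.
have [big_n|small_n] := ltP 1 (i%:R * kmax u n).
  have -> : num_big i u n = n%:R.
    rewrite /num_big (eq_bigr (fun=> 1)) ?sumr_const ?card_ord// => j _.
    rewrite /is_big ifT//; apply: (lt_le_trans big_n).
    by rewrite ler_wpM2l// kmax_nonincreasing// ltnW.
  by move=> p0; rewrite max_l; lra.
have -> : potential i u n = 0.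
  rewrite /potential big_seq big1// => L /seq_max_ge LM.
  by rewrite /cuts ltNge (le_trans _ small_n)// ler_wpM2l.
move=> _; rewrite addr0 max_r// subr_ge0 -[leRHS]mulr1.
rewrite -[X in _ <= X%:R * _]card_ord mulr_natl -sumr_const.
by apply: ler_sum => j _; rewrite /is_big; case: ifP.
Qed.

(** With truncated subtraction, the sum is the integer part of [n ^ 2 / 4]; going from [n] to [n.+2]
    adds [n.+1]. *)
Lemma sum_odd_gaps n :
  (4 * (\sum_(i < n) (n - i.*2.+1)) <= n ^ 2 <= 4 * (\sum_(i < n) (n - i.*2.+1)) + 1)%N.
Proof.
have [m] := ubnP n; elim: m n => // m IHm [|[|n]] nm.
- by rewrite big_ord0.
- by rewrite big_ord1.
have := IHm n; rewrite big_ord_recl.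
have -> : (\sum_(i < n.+1) (n.+2 - (lift ord0 i).*2.+1) = \sum_(i < n) (n - i.*2.+1))%N.
  rewrite big_ord_recr/= [X in (_ + X)%N](_ : _ = 0)%N ?addn0.
    by apply: eq_bigr => i _; rewrite /= /bump /=; lia.
  by rewrite /= /bump /=; lia.
move: (\sum_(i < n) _)%N => t; rewrite /= double0 => /(_ _)/andP[]; first lia.
by move=> *; apply/andP; split; nia.
Qed.

Lemma sum_gaps n : (0 < n)%N ->
  `|\sum_(i < n) Num.max 0 (n%:R - cuts i.+1%:R) - n%:R ^+ 2 / 4| <= 2 :> R.
Proof.
(* The first term is split off: [cuts 1] is 0, not [2 * 1 - 1]. The later terms are the odd gaps of
   [sum_odd_gaps]. *)
case: n => // n _; rewrite big_ord_recl /=.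
have -> : \sum_(i < n) Num.max 0 (n.+1%:R - cuts (lift ord0 i).+1%:R) =
    (\sum_(i < n) (n.+1 - (lift ord0 i).*2.+1))%N%:R :> R.
  rewrite natr_sum; apply: eq_bigr => i _; rewrite lift0 /cuts ltr1n /=.
  have -> : 2 * i.+2%:R - 1 = (i.+1).*2.+1%:R :> R.
    by rewrite -[(i.+1).*2.+1%:R]natr1 -muln2 natrM -[i.+2%:R]natr1; lra.
  have [le|lt] := leqP (i.+1).*2.+1 n.+1.
    by rewrite max_r ?natrB// subr_ge0 ler_nat.
  rewrite max_l; first by rewrite (eqP (ltnW lt : _ - _ == 0)%N).
  by rewrite subr_le0 ler_nat ltnW.
have := sum_odd_gaps n.+1; rewrite big_ord_recl /= subn1 /=.
rewrite /cuts ltxx subr0 max_r//.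
move: (\sum_(i < n) _)%N => t /andP[].
rewrite -!(ler_nat R) ?natrX !(natrD, natrM).
have := @natr1 R n; move: (n.+1%:R) (n%:R) (t%:R) => N n' t' nN A B.
by rewrite ler_norml; apply/andP; split; lra.
Qed.

(** A layer-cake argument: up to an error of 1, the inverse of [kmax u j] counts the [i] in 1..n for
    which [is_big i u j] is 0. Exchanging the sums gives the positive parts of
    [n%:R - num_cuts i u n], and the positive part is 1-Lipschitz. Rounding costs [n], and
    [sum_gaps] costs [2 <= 2 * n]. *)
Lemma sum_inv_kmax u n : (0 < n)%N -> unit_seq u ->
  `|\sum_(j < n) (kmax u j)^-1 - n%:R ^+ 2 / 4| <=
  \sum_(i < n) `|num_cuts i.+1 u n - cuts i.+1%:R| + 3 * n%:R.
Proof.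
move=> n0 u01.
have n1 : 1 <= n%:R :> R by rewrite ler1n.
have h1 : \sum_(j < n) (kmax u j)^-1 - n%:R <=
    \sum_(i < n) Num.max 0 (n%:R - num_cuts i.+1 u n) <= \sum_(j < n) (kmax u j)^-1.
  have -> : \sum_(i < n) Num.max 0 (n%:R - num_cuts i.+1 u n) =
      \sum_(j < n) \sum_(i < n) (if i.+1%:R <= (kmax u j)^-1 then 1 else 0) :> R.
    rewrite exchange_big /=; apply: eq_bigr => i _.
    under [RHS]eq_bigr do rewrite -one_sub_is_big.
    by rewrite -sub_num_big// sumrB sumr_const card_ord.
  have hj (j : 'I_n) : (kmax u j)^-1 - 1 <=
     \sum_(i < n) (if i.+1%:R <= (kmax u j)^-1 then 1 else 0) <= (kmax u j)^-1.
    apply: sum_indic_le; rewrite invr_ge0 ltW ?kmax_gt0//=.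
    by rewrite (le_trans (inv_kmax_le _ _))// ler_nat.
  apply/andP; split; last by apply: ler_sum => j _; case/andP: (hj j).
  rewrite -[X in _ - X%:R]card_ord -sumr_const -sumrB.
  by apply: ler_sum => j _; case/andP: (hj j).
have h2 : `|\sum_(i < n) Num.max 0 (n%:R - num_cuts i.+1 u n) -
    \sum_(i < n) Num.max 0 (n%:R - cuts i.+1%:R)| <=
    \sum_(i < n) `|num_cuts i.+1 u n - cuts i.+1%:R|.
  rewrite -sumrB; apply: (le_trans (ler_norm_sum _ _ _)); apply: ler_sum => i _.
  move: (num_cuts _ _ _) (cuts _) => a b.
  have abN := ler_norm (b - a); rewrite distrC in abN.
  have ab := ler_norm (a - b); rewrite ler_norml.
  by case: (lerP 0 (n%:R - a)) => ?; case: (lerP 0 (n%:R - b)) => ?;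
     apply/andP; split; lra.
have := sum_gaps n0; move: h1 h2.
rewrite ler_norml => /andP[? ?] /andP[? ?]; rewrite !ler_norml => /andP[? ?].
by apply/andP; split; lra.
Qed.
End comparison.

(** * Rate of convergence *)

Section rate.
Context {d : measure_display} {T : measurableType d} {R : realType}.
Variables (P : probability T R) (U : nat -> T -> R).
Hypotheses (uU : forall i, uniform01 P (U i)) (iU : mutually_independent P U).
Local Notation E := (expect P U).

Lemma total_error_le (x : R) u n : (0 < n)%N -> 0 <= x -> unit_seq u ->
  \sum_(k < n) hazard (2 * x / n%:R ^+ 2) u k ^+ 2 +
    `|\sum_(k < n) hazard (2 * x / n%:R ^+ 2) u k - x| <=
  (16 * x ^+ 2 / n%:R + 4 * x / n%:R ^+ 2 *
      (n%:R * Num.sqrt n%:R + 3 * n%:R)) +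
    (4 * x / n%:R ^+ 2 / Num.sqrt n%:R) * \sum_(i < n) lyapunov i.+1 u n.
Proof.
move=> n0 x0 u01.
have N0 : 0 < n%:R :> R by rewrite ltr0n.
set s := Num.sqrt n%:R; have s0 : 0 < s by rewrite sqrtr_gt0.
set c := 4 * x / n%:R ^+ 2.
have c0 : 0 <= c by rewrite divr_ge0 ?exprn_ge0 ?mulr_ge0// ltW.
have hE k : hazard (2 * x / n%:R ^+ 2) u k = c * (kmax u k)^-1.
  by rewrite /hazard /c; congr (_ * _); field; exact: lt0r_neq0.
have -> : \sum_(k < n) hazard (2 * x / n%:R ^+ 2) u k = c * \sum_(k < n) (kmax u k)^-1.
  by rewrite mulr_sumr; apply: eq_bigr => k _; exact: hE.
under eq_bigr do rewrite hE.
(* The inverse of [kmax u k] is at most [k.+1], hence at most [n]. *)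
have h1 : \sum_(k < n) (c * (kmax u k)^-1) ^+ 2 <= 16 * x ^+ 2 / n%:R.
  have -> : 16 * x ^+ 2 / n%:R = \sum_(k < n) (c * n%:R) ^+ 2.
    rewrite sumr_const card_ord -mulr_natl /c; field; exact: lt0r_neq0.
  apply: ler_sum => k _; rewrite ler_pXn2r ?nnegrE ?mulr_ge0//.
    by rewrite ler_wpM2l// (le_trans (inv_kmax_le _ _))// ler_nat.
  by rewrite invr_ge0 ltW// kmax_gt0.
have h2 : `|c * \sum_(k < n) (kmax u k)^-1 - x| =
    c * `|\sum_(k < n) (kmax u k)^-1 - n%:R ^+ 2 / 4|.
  rewrite -[c in RHS](ger0_norm c0) -normrM mulrBr; congr (`|_ - _|).
  by rewrite /c; field; exact: lt0r_neq0.
have h3 := sum_inv_kmax n0 u01.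
(* The inequality [z <= s + z ^+ 2 / s] passes from first to second moments; [s], the square root of
   [n], balances the terms because the variances are O(n). *)
have h4 : \sum_(i < n) `|num_cuts i.+1 u n - cuts i.+1%:R| <=
    n%:R * s + s^-1 * \sum_(i < n) lyapunov i.+1 u n.
  rewrite mulr_sumr mulr_natl -[X in s *+ X]card_ord -sumr_const -big_split/=.
  apply: ler_sum => i _; rewrite /lyapunov.
  have p0 := potential_ge0 i.+1 u n.
  rewrite -real_normK ?num_real//; set z := `|_|.
  have z0 : 0 <= z by exact: normr_ge0.
  rewrite -(ler_pM2l s0) mulrDr mulrA divff ?lt0r_neq0// mul1r.
  by nra.
rewrite h2; apply: (le_trans (lerD h1 (ler_wpM2l c0 (le_trans h3 (lerD h4 (lexx _)))))).
by rewrite le_eqVlt; apply/orP; left; apply/eqP; ring.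
Qed.

Lemma expect_total_error (x : R) n : (0 < n)%N -> 0 <= x -> x <= Num.sqrt n%:R ->
  E (fun u => \sum_(k < n) hazard (2 * x / n%:R ^+ 2) u k ^+ 2 +
    `|\sum_(k < n) hazard (2 * x / n%:R ^+ 2) u k - x|) <= 64 * x / Num.sqrt n%:R.
Proof.
move=> n0 x0.
have N0 : 0 < n%:R :> R by rewrite ltr0n.
set s := Num.sqrt n%:R => xs; have s0 : 0 < s by rewrite sqrtr_gt0.
have s2 : s ^+ 2 = n%:R by rewrite sqr_sqrtr// ltW.
have s1 : 1 <= s by rewrite -sqrtr1 ler_sqrt// ler1n.
set y := 2 * x / n%:R ^+ 2; 
have y0 : 0 <= y by rewrite divr_ge0 ?exprn_ge0 ?mulr_ge0// ltW.
set A := 16 * x ^+ 2 / n%:R + 4 * x / n%:R ^+ 2 * (n%:R * s + 3 * n%:R).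
set B := 4 * x / n%:R ^+ 2 / s.
have blyap (i : 'I_n) : bounded_adapted n (fun u : nat -> R => lyapunov i.+1 u n).
  exact: bounded_adapted_lyapunov.
have bS : bounded_adapted n (fun u : nat -> R => \sum_(i < n) lyapunov i.+1 u n).
  exact: bounded_adapted_sum.
have bBS := bounded_adaptedM (bounded_adapted_cst n B) bS.
have bhaz (k : 'I_n) : bounded_adapted n (fun u => hazard y u k).
  exact: bounded_adaptedW (ltnW (ltn_ord k)) (bounded_adapted_hazard y k).
have btot : bounded_adapted n (fun u => \sum_(k < n) hazard y u k ^+ 2 +
    `|\sum_(k < n) hazard y u k - x|).
  apply: bounded_adaptedD.
    by apply: bounded_adapted_sum => k; exact: bounded_adapted_sqr.
  apply: bounded_adapted_norm; apply: bounded_adaptedB; last exact: bounded_adapted_cst.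
  exact: bounded_adapted_sum.
have le1 : E (fun u => \sum_(k < n) hazard y u k ^+ 2 +
    `|\sum_(k < n) hazard y u k - x|) <=
    E (fun u => A + B * \sum_(i < n) lyapunov i.+1 u n).
  apply: (le_expect uU btot (bounded_adaptedD (bounded_adapted_cst n A) bBS)) => u u01.
  exact: total_error_le.
apply: (le_trans le1).
rewrite (expectD uU (bounded_adapted_cst n A) bBS) expect_cst (expectZ uU _ bS).
rewrite (expect_sum uU blyap).
have le2 : \sum_(i < n) E (fun u => lyapunov i.+1 u n) <= 8 * n%:R ^+ 2.
  have -> : 8 * n%:R ^+ 2 = \sum_(i < n) (8 * n%:R) :> R.
    by rewrite sumr_const card_ord -mulr_natl; ring.
  apply: ler_sum => i _; apply: (le_trans (expect_lyapunov _ _ uU iU)).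
  by rewrite ler_wpM2l// ler_nat.
have B0 : 0 <= B by rewrite /B !divr_ge0 ?exprn_ge0 ?mulr_ge0// ltW.
apply: (le_trans (lerD (lexx A) (ler_wpM2l B0 le2))).
(* Since [x / s] and [s^-1] are at most 1, the coefficients add up to [16 + 36 + 12 = 64]. *)
have -> : A + B * (8 * n%:R ^+ 2) =
    16 * (x / s) * (x / s) + 36 * (x / s) + 12 * (x / s) * s^-1.
  by rewrite /A /B -s2; field; exact: lt0r_neq0.
have xs0 : 0 <= x / s by rewrite divr_ge0// ltW.
have xs1 : x / s <= 1 by rewrite ler_pdivrMr// mul1r.
have sV1 : s^-1 <= 1 by rewrite invf_le1.
by rewrite -mulrA; nra.
Qed.

Lemma drive_id w : unit_seq (fun i => U i w) -> drive U w = fun i => U i w.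
Proof. by move=> w01; apply/funext => i; rewrite /drive clamp_id. Qed.

(** The [U i] leave [0, 1] only on a countable union of null events, so events that agree off it
    have equal probability. *)
Lemma measure_eq_drive (A A' : set T) : measurable A -> measurable A' ->
  (forall w, unit_seq (fun i => U i w) -> A w <-> A' w) -> P A = P A'.
Proof.
pose N := \bigcup_i (U i @^-1` (~` `[0, 1]%classic)).
have mI : measurable (~` (`[0, 1]%classic : set R)).
  by apply: measurableC; exact: measurable_itv.
have mUC i : measurable (U i @^-1` (~` `[0, 1]%classic)).
  by rewrite -[X in measurable X]setTI; exact: (uU i).1.
have mN : measurable N by exact: bigcupT_measurable.
have PN : P N = 0%E.
  apply: measure_negligible => //; apply: negligible_bigcup => i.
  apply/negligibleP => //; apply: etrans ((uU i).2 _ mI) _.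
  by rewrite setICl measure0.
have notN w : ~ N w -> unit_seq (fun i => U i w).
  move=> nN i; have [//|nu] := pselect (0 <= U i w <= 1); exfalso; apply: nN.
  by exists i => //=; rewrite in_itv.
have half (C C' : set T) : measurable C -> measurable C' ->
    (forall w, unit_seq (fun i => U i w) -> C w -> C' w) -> (P C <= P C')%E.
  move=> mC mC' CC'; apply: (@le_trans _ _ (P (C' `|` N))).
    apply: le_measure; rewrite ?inE//; first exact: measurableU.
    move=> w Cw; have [Nw|/notN w01] := pselect (N w); first by right.
    by left; exact: CC'.
  by rewrite -[leRHS]adde0 -PN; exact: measureU2.
move=> mA mA' AA'; apply/eqP; rewrite eq_le; apply/andP; split.
  by apply: half => // w /AA'[].
by apply: half => // w /AA'[].
Qed.

Lemma prob_alive (x : R) n : (0 < n)%N -> 0 <= x ->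
  fine (P [set w | (n%:R ^+ 2 * kakutani_min (fun k => U k w) n) / 2 > x]) =
  E (fun u => alive (2 * x / n%:R ^+ 2) u n).
Proof.
move=> n0 x0; have N0 : 0 < n%:R :> R by rewrite ltr0n.
set y := 2 * x / n%:R ^+ 2.
pose A (u : nat -> R) := alive y u n = 1.
have aliveP u : (x < n%:R ^+ 2 * kakutani_min u n / 2) <-> A u.
  rewrite /A /alive /kakutani_min -lt_seq_min ?kakutani_lengths_neq0//.
  have -> : (y < seq_min (kakutani_lengths u n)) =
      (x < n%:R ^+ 2 * seq_min (kakutani_lengths u n) / 2).
    rewrite /y ltr_pdivrMr ?exprn_gt0// ltr_pdivlMr//.
    by rewrite (mulrC 2) (mulrC (seq_min _)).
  by case: ifP => // _; split=> // /eqP; rewrite eq_sym oner_eq0.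
have aA := (bounded_adapted_alive y n).1.
have m1 : measurable_fun setT (fun w => alive y (fun k => U k w) n).
  by apply: (aA _ _ (fun i w => U i w)) => i _; exact: (uU i).1.
have m2 : measurable_fun setT (fun w => alive y (drive U w) n).
  exact: (measurable_drive uU aA).
have mset (f : T -> R) : measurable_fun setT f -> measurable [set w | f w = 1].
  move=> mf; rewrite -[X in measurable X]setTI; exact: (mf measurableT [set 1]).
have -> : [set w | (n%:R ^+ 2 * kakutani_min (fun k => U k w) n) / 2 > x] =
    [set w | alive y (fun k => U k w) n = 1].
  by apply/seteqP; split=> w /aliveP.
rewrite (@measure_eq_drive _ [set w | alive y (drive U w) n = 1]); first last.
- by move=> w w01; rewrite /= drive_id.
- exact: mset.
- exact: mset.
rewrite /expect /Rintegral; congr fine.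
rewrite -[in LHS](setIT [set w | _]) -integral_indic//; last exact: mset.
apply: eq_integral => w _; rewrite indicE; congr (_%:E).
rewrite /alive; case: ifP => h; first by rewrite mem_set//= h.
by rewrite memNset//= h => /eqP; rewrite eq_sym oner_eq0.
Qed.

Lemma prob_min_bound (x : R) n : (0 < n)%N -> 0 <= x -> x <= ln n%:R / 2 ->
  `|fine (P [set w | (n%:R ^+ 2 * kakutani_min (fun k => U k w) n) / 2 > x])
    - expR (- x)| <= 32 * ln n%:R / Num.sqrt n%:R.
Proof.
move=> n0 x0 xln; have N0 : 0 < n%:R :> R by rewrite ltr0n.
have N1 : 1 <= n%:R :> R by rewrite ler1n.
set s := Num.sqrt n%:R; have s0 : 0 < s by rewrite sqrtr_gt0.
have s2 : s ^+ 2 = n%:R by rewrite sqr_sqrtr// ltW.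
have le_ln (t : R) : 0 < t -> ln t <= t - 1.
  by move=> t0; have := @le_ln1Dx R (t - 1); rewrite subrKC; apply; lra.
(* This yields [x <= s], while [ln n%:R <= n%:R - 1] yields [y < 1], as the two estimates applied
   below require. *)
have lnN : ln n%:R <= 2 * s - 2.
  by rewrite -s2 lnXn// -mulr_natl; have := le_ln _ s0; lra.
have lnN' := le_ln _ N0.
have y0 : 0 <= 2 * x / n%:R ^+ 2 by rewrite divr_ge0 ?exprn_ge0 ?mulr_ge0// ltW.
have y1 : 2 * x / n%:R ^+ 2 < 1 by rewrite ltr_pdivrMr ?exprn_gt0// mul1r; nra.
rewrite prob_alive//.
apply: (le_trans (expect_alive x0 y0 uU iU n y1)).
apply: (le_trans (expect_total_error n0 x0 _)); first by rewrite -/s; lra.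
by rewrite ler_pM2r ?invr_gt0//; lra.
Qed.
End rate.

Theorem theorem1p4 (R : realType) :
  exists C : R, 0 <= C /\
  forall (d : measure_display) (T : measurableType d) (P : probability T R)
    (U : nat -> T -> R),
    (forall i, uniform01 P (U i)) ->
    mutually_independent P U ->
    forall n : nat, (0 < n)%N ->
    forall x : R, 0 <= x ->
      `| fine (P [set w | (n%:R ^+ 2 * kakutani_min (fun k => U k w) n) / 2 > x])
         - expR (- x) | <= C * (1 + ln n%:R) / Num.sqrt n%:R.
Proof.
exists 32; split => // d T P U uU iU n n0 x x0.
have N0 : 0 < n%:R :> R by rewrite ltr0n.
have N1 : 1 <= n%:R :> R by rewrite ler1n.
have ln0 : 0 <= ln n%:R :> R by exact: ln_ge0.
set s := Num.sqrt n%:R; have s0 : 0 < s by rewrite sqrtr_gt0.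
have sV0 : 0 < s^-1 by rewrite invr_gt0.
(* The extra [s^-1] is room for the exponential at the threshold [x' = ln n%:R / 2], where it equals
   [s^-1]. *)
have bound_half : 32 * ln n%:R / s + s^-1 <= 32 * (1 + ln n%:R) / s by nra.
have [xln|lnx] := leP x (ln n%:R / 2).
  apply: (le_trans (prob_min_bound uU iU n0 x0 xln)); rewrite -/s; lra.
set x' := ln n%:R / 2 in lnx; have x'0 : 0 <= x' by rewrite /x'; lra.
have ex' : expR (- x') = s^-1.
  rewrite expRN; congr (_^-1); apply: (@pexpIrn _ 2) => //;
    rewrite ?nnegrE ?expR_ge0 ?ltW//.
  rewrite sqr_sqrtr ?ltW// -expRM_natl /x' -{2}(lnK (x := n%:R)) ?posrE//.
  by congr expR; lra.
have := prob_min_bound uU iU n0 x'0 (lexx _); rewrite -/s ex'.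
(* Beyond [x'], the probability lies between 0 and its value at [x'], which is at most [s^-1] plus
   the error there, and [expR (- x)] lies between 0 and [s^-1]. *)
have mono : fine (P [set w | (n%:R ^+ 2 * kakutani_min (fun k => U k w) n) / 2 > x]) <=
            fine (P [set w | (n%:R ^+ 2 * kakutani_min (fun k => U k w) n) / 2 > x']).
  rewrite !prob_alive//; apply: (le_expect uU (bounded_adapted_alive _ n)
    (bounded_adapted_alive _ n)) => u u01.
  rewrite /alive; case: ifP => [/allP al|_]; last by case: ifP.
  rewrite ifT//; apply/allP => L /al; apply: le_lt_trans.
  by rewrite ler_pM2r ?invr_gt0 ?exprn_gt0// ler_pM2l// ltW.
have p0 : 0 <= fine (P [set w | (n%:R ^+ 2 * kakutani_min (fun k => U k w) n) / 2 > x]).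
  exact: fine_ge0.
have e1 : expR (- x) <= s^-1 by rewrite -ex' ler_expR lerN2 ltW.
have e0 := expR_ge0 (- x).
move: mono p0; move: (fine _) (fine _) => p p' pp' p0.
by rewrite !ler_norml => /andP[? ?]; apply/andP; split; lra.
Qed.
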